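(* Let $D_n\in\mathbb{N}$, $\rho_n\in(0,1]$, $\lambda_n>0$ be sequences, and consider the spiked Wigner model with prior $\mathcal{X}=\mathcal{X}_n^{\rho_n}$ (sparse Rademacher). Suppose $D_n=o(n)$. If one of the following holds for sufficiently large $n$: (a) $\limsup_{n\to\infty}\lambda_n<1$ and $$\rho_n\ge \max\left(1,\sqrt{\frac{1}{6\log(1/\lambda_n)}}\right)\sqrt{\frac{D_n}{n}},\quad\text{or}$$ (b) $\limsup_{n\to\infty}\lambda_n<1/\sqrt3$ and $$\rho_n\ge \lambda_n\sqrt{\frac{D_n}{n}},$$ then, as $n\to\infty$, $\|L_{n,\lambda,\mathcal{X}}^{\le D_n}\| = O(1)$.
   Context: Sparse Rademacher prior $\mathcal{X}_n^\rho$: the law on $\mathbb{R}^n$ of $x$ with i.i.d. entries equal to $+1/\sqrt{\rho n}$ with probability $\rho/2$, $-1/\sqrt{\rho n}$ with probability $\rho/2$, and $0$ with probability $1-\rho$. $\mathsf{GOE}(n)$ is the law of a random symmetric $n\times n$ matrix $W$ with entries independent up to symmetry, $W_{ii}\sim\mathcal{N}(0,2/n)$ and $W_{ij}=W_{ji}\sim\mathcal{N}(0,1/n)$ for $i<j$. Spiked Wigner model with prior $\mathcal{X}$: under $\mathbb{P}_n$, draw $x\sim\mathcal{X}$ and independently $W\sim\mathsf{GOE}(n)$ and observe $Y=W+\lambda xx^\top$; under $\mathbb{Q}_n$, observe $Y\sim\mathsf{GOE}(n)$. Low-degree likelihood ratio: let $L=d\mathbb{P}_n/d\mathbb{Q}_n$,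 and let $L^{\le D}=L_{n,\lambda,\mathcal{X}}^{\le D}$ be its orthogonal projection, with respect to $\langle f,g\rangle=\mathbb{E}_{\mathbb{Q}_n}[fg]$, onto the space of polynomials of degree at most $D$ in the entries of $Y$; i.e. $L^{\le D}$ is the unique polynomial of degree at most $D$ (in the entries $Y_{ij}$, $i\le j$) with $\mathbb{E}_{\mathbb{Q}_n}[L^{\le D}f]=\mathbb{E}_{\mathbb{P}_n}[f]$ for all polynomials $f$ of degree at most $D$. The norm is $\|f\|=\mathbb{E}_{\mathbb{Q}_n}[f^2]^{1/2}$. *)

(* Defs.v *)
From HB Require Import structures.
From mathcomp Require Import all_boot all_order all_algebra.
From mathcomp Require Import -(notations) mpoly.
From mathcomp Require Import all_classical all_reals all_analysis.
From mathcomp Require Import measurable_realfun.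

Set Implicit Arguments.
Unset Strict Implicit.
Unset Printing Implicit Defensive.

Import Order.TTheory GRing.Theory Num.Theory.
Import numFieldNormedType.Exports.

Local Open Scope classical_set_scope.
Local Open Scope ring_scope.

Section product_probability.
Context d (T : measurableType d) (R : realType).

Definition cons_pair n (z : T * n.-tuple T) : n.+1.-tuple T :=
  [tuple of z.1 :: z.2].

Lemma measurable_cons_pair n : measurable_fun [set: T * n.-tuple T] (@cons_pair n).
Proof. exact: measurable_cons. Qed.

HB.instance Definition _ n := isMeasurableFun.Build _ _ _ _ (@cons_pair n)
  (@measurable_cons_pair n).

(* The law of (z_0, ..., z_{n-1}) with independent z_i ~ mu i. *)
Fixpoint prod_prob n : ('I_n -> probability T R) -> probability (n.-tuple T) R :=
  match n with
  | 0 => fun _ => \d_[tuple]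
  | m.+1 => fun mu =>
      distribution (mu ord0 \x prod_prob (fun i => mu (lift ord0 i)))%E
        (@cons_pair m)
  end.

Lemma prod_probE n (mu : 'I_n -> probability T R) (A : 'I_n -> set T) :
    (forall i, measurable (A i)) ->
  prod_prob mu [set z | forall i, A i (tnth z i)] = (\prod_(i < n) mu i (A i))%E.
Proof.
elim: n mu A => [|n IH] mu A mA.
  rewrite big_ord0 /= diracE mem_set//= => -[]; done.
rewrite big_ord_recl/= /distribution/= /pushforward/=.
rewrite -IH; last by move=> i; exact: mA.
rewrite -product_measure1E //; last first.
  rewrite (_ : [set z | _] = \bigcap_(i in [set: 'I_n])
      ((@tnth n T ^~ i) @^-1` A (lift ord0 i))); last first.
    by apply/seteqP; split=> z /= h i; [move=> _|]; exact: h.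
  apply: fin_bigcap_measurable => // i _.
  by rewrite -[X in measurable X]setTI; exact: measurable_tnth.
congr product_measure1; apply/seteqP; split => -[x z] /=.
  move=> h; split; first exact: (h ord0).
  by move=> i; have := h (lift ord0 i); rewrite /cons_pair tnthS.
move=> [h0 h] i; case: (unliftP ord0 i) => [j|] ->; last exact: h0.
by rewrite /cons_pair tnthS; exact: h.
Qed.

End product_probability.

Section sparse_rademacher.
Context {R : realType} (n : nat) (rho : R).

Let a : measurableTypeR R := (Num.sqrt (rho * n%:R))^-1.
Let b : measurableTypeR R := - (Num.sqrt (rho * n%:R))^-1.
Let z : measurableTypeR R := 0.

(* The law of one entry of x; the else branch only makes the definition total. *)
Definition sparse_rademacher_entry : set (measurableTypeR R) -> \bar R :=
  fun A => if 0 <= rho <= 1 then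
    ((rho / 2)%:E * \d_a A + (rho / 2)%:E * \d_b A + (1 - rho)%:E * \d_z A)%E
  else \d_z A.

Let mass0 : sparse_rademacher_entry set0 = 0%E.
Proof.
by rewrite /sparse_rademacher_entry; case: ifPn => _; rewrite !measure0 ?mule0 ?adde0.
Qed.

Let mass_ge0 A : (0 <= sparse_rademacher_entry A)%E.
Proof.
rewrite /sparse_rademacher_entry; case: ifPn => [/andP[h0 h1]|_]//.
by rewrite !adde_ge0// mule_ge0// lee_fin ?divr_ge0 ?subr_ge0.
Qed.

Let mass_sigma_additive : semi_sigma_additive sparse_rademacher_entry.
Proof.
have [/andP[h0 h1]|h] := boolP (0 <= rho <= 1); last first.
  rewrite (_ : sparse_rademacher_entry = \d_z).
    exact: measure_semi_sigma_additive.
  by apply/funext => A; rewrite /sparse_rademacher_entry (negbTE h).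
have h2 : 0 <= rho / 2 by rewrite divr_ge0.
have h3 : 0 <= 1 - rho by rewrite subr_ge0.
rewrite (_ : sparse_rademacher_entry =
  measure_add (measure_add (mscale (NngNum h2) \d_a) (mscale (NngNum h2) \d_b))
    (mscale (NngNum h3) \d_z)).
  exact: measure_semi_sigma_additive.
apply/funext => A; rewrite /sparse_rademacher_entry h0 h1.
by rewrite measure_addE/= /msum big_ord_recr/= big_ord1.
Qed.

HB.instance Definition _ := isMeasure.Build _ _ _ sparse_rademacher_entry
  mass0 mass_ge0 mass_sigma_additive.

Let mass_setT : sparse_rademacher_entry [set: _] = 1%E.
Proof.
rewrite /sparse_rademacher_entry; case: ifPn => _; rewrite !diracT// !mule1.
by rewrite -!EFinD -splitr subrKC.
Qed.

HB.instance Definition _ :=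
  @Measure_isProbability.Build _ _ R sparse_rademacher_entry mass_setT.

End sparse_rademacher.

Definition sparse_rademacher {R : realType} (n : nat) (rho : R) :
    probability (n.-tuple (measurableTypeR R)) R :=
  prod_prob (fun _ : 'I_n => sparse_rademacher_entry n rho).

(* A symmetric matrix Y is encoded by its entries Y_ij with i <= j. *)
Definition upper (n : nat) : finType := {ij : 'I_n * 'I_n | ij.1 <= ij.2}%N.

Definition symmx (R : realType) (n : nat) := #|upper n|.-tuple (measurableTypeR R).

Definition entry_row {n : nat} (k : 'I_#|upper n|) : 'I_n := (val (enum_val k)).1.
Definition entry_col {n : nat} (k : 'I_#|upper n|) : 'I_n := (val (enum_val k)).2.

(* normal_prob takes the standard deviation, not the variance. *)
Definition GOE {R : realType} (n : nat) : probability (symmx R n) R :=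
  prod_prob (fun k : 'I_#|upper n| =>
    normal_prob (0 : R)
      (Num.sqrt ((if entry_row k == entry_col k then 2 else 1) / n%:R))).

Section spiked_wigner.
Context {R : realType} (n : nat) (lambda : R).

Definition add_spike (xW : n.-tuple (measurableTypeR R) * symmx R n) : symmx R n :=
  [tuple (tnth xW.2 k
          + lambda * (tnth xW.1 (entry_row k) * tnth xW.1 (entry_col k)) : R)
    | k < #|upper n|].

Lemma measurable_add_spike : measurable_fun setT add_spike.
Proof.
apply/measurable_fun_tnthP => k.
pose f (xW : n.-tuple (measurableTypeR R) * symmx R n) : R :=
  tnth xW.2 k + lambda * (tnth xW.1 (entry_row k) * tnth xW.1 (entry_col k)).
rewrite (_ : _ \o _ = f); last by apply/funext => xW /=; rewrite tnth_mktuple.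
have m1 i : measurable_fun setT
    (fun xW : n.-tuple (measurableTypeR R) * symmx R n => tnth xW.1 i : R).
  exact: (measurableT_comp (measurable_tnth i) measurable_fst).
have m2 i : measurable_fun setT
    (fun xW : n.-tuple (measurableTypeR R) * symmx R n => tnth xW.2 i : R).
  exact: (measurableT_comp (measurable_tnth i) measurable_snd).
apply: measurable_funD; first exact: m2.
apply: measurable_funM; first exact: measurable_cst.
by apply: measurable_funM; exact: m1.
Qed.

HB.instance Definition _ := isMeasurableFun.Build _ _ _ _ add_spike
  measurable_add_spike.

Definition spiked_wigner (X : probability (n.-tuple (measurableTypeR R)) R) :
    probability (symmx R n) R :=
  distribution (X \x GOE n)%E add_spike.

End spiked_wigner.

(* L is a version of dP/dQ. *)
Definition is_likelihood_ratio d (T : measurableType d) (R : realType)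
    (P Q : probability T R) (L : T -> R) : Prop :=
  [/\ measurable_fun setT L, (forall y, 0 <= L y) &
      forall A, measurable A -> P A = (\int[Q]_(y in A) (L y)%:E)%E].

(* Polynomials in the entries Y_ij, i <= j. *)
Definition polymx (R : realType) (n : nat) := mpoly #|upper n| R.

Definition polymx_eval {R : realType} {n : nat} (p : polymx R n) (Y : symmx R n) : R :=
  meval (tnth Y) p.

(* mmeasure mdeg (msize) is the total degree plus one, and 0 for p = 0. *)
Definition degree_le {R : realType} {n : nat} (D : nat) (p : polymx R n) : Prop :=
  (mmeasure mdeg p <= D.+1)%N.

(* p has degree at most D and L - p is orthogonal, in L^2(Q), to every such
   polynomial. *)
Definition is_low_degree_projection {R : realType} {n : nat}
    (Q : probability (symmx R n) R) (D : nat) (L : symmx R n -> R)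
    (p : polymx R n) : Prop :=
  degree_le D p /\
  forall f : polymx R n, degree_le D f ->
    ('E_Q[(fun Y => (L Y - polymx_eval p Y) * polymx_eval f Y)%R] = 0)%E.

Definition L2norm d (T : measurableType d) (R : realType) (Q : probability T R)
    (f : T -> R) : \bar R :=
  ('E_Q[(fun y => f y ^+ 2)%R] `^ 2^-1)%E.

(* Main.v *)
Require Import Defs.
From mathcomp Require Import all_boot all_order all_algebra.
From mathcomp Require Import -(notations) mpoly.
From mathcomp Require Import all_classical all_reals all_analysis.
From mathcomp Require Import measurable_realfun ring lra.
Import Order.TTheory GRing.Theory Num.Theory.
Import numFieldNormedType.Exports.
Local Open Scope classical_set_scope.
Local Open Scope ring_scope.

Set Implicit Arguments.
Unset Strict Implicit.
Unset Printing Implicit Defensive.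

(** Write Q for the Gaussian law of the observation, P for the planted law, and p
    for the projection of dP/dQ onto polynomials of degree at most [D].

    Reduction to the overlap. Testing the defining property of p on p itself
    gives E_Q[p^2] = E_P[p]. The spike takes finitely many values, so P is a
    finite mixture of translates of Q by vectors mu_s with weights w_s. Let M be
    the Hermite polynomial of degree at most [D] whose coefficients are the mixed
    moments of the translation vector ([mixture_projection]). Gaussian
    integration by parts ([stein]) and Taylor expansion give E_Q[f M] = E_P[f] for
    every polynomial f of degree at most [D], so that
    0 <= E_Q[(p - M)^2] = E_Q[M^2] - E_Q[p^2]. Orthogonality of the Hermite
    polynomials and the multinomial theorem ([sum_multinomial_expr]) evaluate
    E_Q[M^2] as the average over independent s and t of the truncated exponential
    series of <mu_s, mu_t>. In the spiked Wigner model
    <mu_s, mu_t> = lambda^2 n <x, x'>^2 / 2 ([sum_upper_sqr]).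

    Bound on the overlap. Put m = n rho^2. The overlap is a sum of n independent
    lazy symmetric steps, and its exact moment generating function ([overlap_mgf])
    together with cosh t <= 1 + t^2/2 + t^4/16 for t^2 <= 2 controls the moment of
    order 2d for every such t. With (2d)! <= 4^d (d!)^2 and
    d! <= e d (d/e)^d, the term of degree d is at most
      2 e d (2 d lambda^2 / (t^2 m))^d exp(- d + m (t^2/2 + t^4/16))
    ([projection_term_le]). If D <= m and D <= 6 m log(1/lambda), the choice
    t^2 = 2 d / m makes this at most 2 e d lambda^(d/2). If lambda^2 D <= m and
    lambda^2 <= 1/3, the choice t^2 = 2 lambda^2 d / m makes it at most
    2 e d exp(- 7 d / 12). Both bounds are summable in d, uniformly in n. *)

(** * Means of real functions *)

Section is_mean.
Context d (T : measurableType d) (R : realType) (mu : {measure set T -> \bar R}).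
Implicit Types (f g : T -> R).

(** [f] is integrable with integral [c]. Stating both at once makes means of finite
    sums and products compose without side conditions. *)
Definition is_mean f (c : R) : Prop :=
  mu.-integrable setT (EFin \o f) /\ (\int[mu]_x (f x)%:E = c%:E)%E.

Lemma is_mean_uniq f c c' : is_mean f c -> is_mean f c' -> c = c'.
Proof. by move=> [_ h] [_ h']; apply: EFin_inj; rewrite -h -h'. Qed.

Lemma is_mean_ext f g c : f =1 g -> is_mean f c -> is_mean g c.
Proof. by move=> /funext ->. Qed.

Lemma is_mean_measurable f c : is_mean f c -> measurable_fun setT f.
Proof. by move=> [/measurable_int/measurable_EFinP]. Qed.

Lemma is_meanZ k f c : is_mean f c -> is_mean (fun x => k * f x) (k * c).
Proof.
move=> [fi fE]; split.
  rewrite (_ : _ \o _ = fun x => (k%:E * (EFin \o f) x)%E); last by apply/funext.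
  exact: integrableZl.
under eq_integral do rewrite EFinM.
by rewrite (@integralZl _ _ _ _ _ _ (EFin \o f))// fE EFinM.
Qed.

Lemma is_meanD f g c c' : is_mean f c -> is_mean g c' ->
  is_mean (fun x => f x + g x) (c + c').
Proof.
move=> [fi fE] [gi gE]; split.
  rewrite (_ : _ \o _ = (EFin \o f) \+ (EFin \o g))%E; last by apply/funext.
  exact: integrableD.
under eq_integral do rewrite EFinD.
by rewrite (@integralD _ _ _ _ _ _ (EFin \o f) (EFin \o g))// fE gE EFinD.
Qed.

Lemma is_meanB f g c c' : is_mean f c -> is_mean g c' ->
  is_mean (fun x => f x - g x) (c - c').
Proof.
move=> fc gc; have := is_meanD fc (is_meanZ (-1) gc); rewrite mulN1r.
by apply: is_mean_ext => x; rewrite mulN1r.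
Qed.

Lemma is_mean0 : is_mean (fun=> 0) 0.
Proof. by split; [exact: integrable0|rewrite integral0]. Qed.

Lemma is_mean_sum (I : Type) (s : seq I) (P : pred I) (F : I -> T -> R) (c : I -> R) :
    (forall i, P i -> is_mean (F i) (c i)) ->
  is_mean (fun x => \sum_(i <- s | P i) F i x) (\sum_(i <- s | P i) c i).
Proof.
move=> h; elim: s => [|i s IH].
  by rewrite big_nil; apply: is_mean_ext is_mean0 => x; rewrite big_nil.
rewrite big_cons; case: ifPn => Pi.
  apply: (is_mean_ext _ (is_meanD (h _ Pi) IH)) => x.
  by rewrite big_cons Pi.
by apply: is_mean_ext IH => x; rewrite big_cons (negbTE Pi).
Qed.

Lemma is_mean_ge0 f c : (forall x, 0 <= f x) -> is_mean f c -> 0 <= c.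
Proof.
by move=> f0 [_ fE]; rewrite -lee_fin -fE integral_ge0// => x _; rewrite lee_fin.
Qed.

Lemma integrable_is_mean f : mu.-integrable setT (EFin \o f) ->
  is_mean f (\int[mu]_x f x).
Proof. by move=> fi; split => //; rewrite fineK// integrable_fin_num. Qed.

End is_mean.

Section density.
Context d (T : measurableType d) (R : realType).
Variables (nu mu : {measure set T -> \bar R}) (g : T -> R).
Hypotheses (mg : measurable_fun setT g) (g0 : forall x, 0 <= g x).
Hypothesis nuE : forall A, measurable A -> nu A = (\int[mu]_(x in A) (g x)%:E)%E.

Import HBNNSimple.

(** Change of measure for a real density, by approximation with simple functions. *)
Lemma ge0_integral_density (f : T -> \bar R) :
    (forall x, 0 <= f x)%E -> measurable_fun setT f ->
  (\int[nu]_x f x = \int[mu]_x (f x * (g x)%:E))%E.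
Proof.
move=> f0 mf; have mge : measurable_fun setT (EFin \o g) by exact/measurable_EFinP.
pose h := nnsfun_approx measurableT mf.
have -> : (\int[nu]_x f x = lim (\int[nu]_x (EFin \o h n) x @[n --> \oo]))%E.
  have fE x : f x = lim ((EFin \o h n) x @[n --> \oo]).
    by apply/esym/cvg_lim => //; exact: cvg_nnsfun_approx.
  under eq_integral => x _ do rewrite fE.
  apply: monotone_convergence => //.
  - by move=> n; apply/measurable_EFinP/measurable_funP.
  - by move=> n x _ //=; rewrite lee_fin.
  - by move=> x _ a b ab; rewrite lee_fin; exact/lefP/nd_nnsfun_approx.
have -> : (\int[mu]_x (f x * (g x)%:E) =
    lim (\int[mu]_x ((EFin \o h n) x * (g x)%:E) @[n --> \oo]))%E.
  have fg x : (f x * (g x)%:E = lim ((EFin \o h n) x * (g x)%:E @[n --> \oo]))%E.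
    by apply/esym/cvg_lim => //; apply: cvgeZr => //; exact: cvg_nnsfun_approx.
  under eq_integral => x _ do rewrite fg.
  apply: monotone_convergence => //.
  - by move=> n; apply: emeasurable_funM => //; exact/measurable_EFinP.
  - by move=> n x _; rewrite mule_ge0 ?lee_fin.
  - by move=> x _ a b ab; rewrite lee_wpmul2r ?lee_fin//; exact/lefP/nd_nnsfun_approx.
suff suf n : (\int[nu]_x (EFin \o h n) x = \int[mu]_x ((EFin \o h n) x * (g x)%:E))%E.
  by under eq_fun do rewrite suf.
transitivity (\int[nu]_x (\sum_(y \in range (h n)) (y * \1_(h n @^-1` [set y]) x)%:E))%E.
  by apply: eq_integral => t tE; rewrite /= fimfunE -fsumEFin.
transitivity (\int[mu]_x (\sum_(y \in range (h n))
    ((y * \1_(h n @^-1` [set y]) x)%:E * (g x)%:E)))%E; last first.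
  apply: eq_integral => x _.
  rewrite -ge0_mule_fsuml => [|y]; last exact: nnfun_muleindic_ge0.
  by rewrite fsumEFin// -(fimfunE _ x).
rewrite ge0_integral_fsum//; last 2 first.
  - by move=> r; apply/measurable_EFinP/measurable_funM.
  - by move=> m y _; exact: nnfun_muleindic_ge0.
rewrite ge0_integral_fsum//; last 2 first.
  - by move=> y; apply: emeasurable_funM => //; apply/measurable_EFinP/measurable_funM.
  - by move=> m y _; rewrite mule_ge0 ?lee_fin// -lee_fin; exact: nnfun_muleindic_ge0.
apply: eq_fsbigr => r rhn.
have r0 : 0 <= r by move: rhn; rewrite inE => -[t _ <-].
have mA : measurable (h n @^-1` [set r]) by [].
under eq_integral do rewrite EFinM.
rewrite ge0_integralZl//; last exact/measurable_EFinP.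
rewrite integral_indic// setIT nuE//.
under [RHS]eq_integral do rewrite EFinM -muleA.
rewrite [RHS]ge0_integralZl//; last 2 first.
- by apply: emeasurable_funM => //; apply/measurable_EFinP.
- by move=> x _; rewrite mule_ge0 ?lee_fin.
congr (_ * _)%E; rewrite integral_mkcond; apply: eq_integral => x _.
by rewrite /patch indicE; case: ifPn => _; rewrite ?mul1e ?mul0e.
Qed.

Lemma is_mean_density (f : T -> R) c :
  is_mean nu f c -> is_mean mu (fun x => f x * g x) c.
Proof.
move=> [fi fE].
have mf := measurable_int _ fi; have mfr : measurable_fun setT f by exact/measurable_EFinP.
split.
  apply/integrableP; split; first by apply/measurable_EFinP/measurable_funM.
  have /integrableP[_] := fi.
  rewrite ge0_integral_density//; last exact: measurableT_comp.
  by move=> foo; under eq_integral do rewrite /= normrM EFinM (ger0_norm (g0 _)).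
rewrite -fE integralE [RHS]integralE.
have mg' : measurable_fun setT (fun x => f x * g x) by exact: measurable_funM.
rewrite !ge0_integral_density//; last 2 first.
- exact: measurable_funeneg.
- exact: measurable_funepos.
by congr (_ - _)%E; apply: eq_integral => x _;
  rewrite ?funeposE ?funenegE /= -?EFinN -?EFin_max -?EFinM maxr_pMl ?mul0r ?mulNr.
Qed.

Lemma density_is_mean (f : T -> R) c : measurable_fun setT f ->
  is_mean mu (fun x => f x * g x) c -> is_mean nu f c.
Proof.
move=> mf [fi fE].
have fin : nu.-integrable setT (EFin \o f).
  apply/integrableP; split; first exact/measurable_EFinP.
  rewrite ge0_integral_density//; last by apply: measurableT_comp => //; exact/measurable_EFinP.
  have /integrableP[_] := fi.
  by under eq_integral do rewrite /= normrM EFinM (ger0_norm (g0 _)).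
have fm := integrable_is_mean fin.
by rewrite -(is_mean_uniq (is_mean_density fm) (conj fi fE)).
Qed.

End density.

Lemma is_mean_distribution d d' (T : measurableType d) (T' : measurableType d')
    (R : realType) (P : probability T R) (X : {mfun T >-> T'}) (f : T' -> R) c :
    measurable_fun setT f -> is_mean P (f \o X) c ->
  is_mean (distribution P X) f c.
Proof.
move=> mf [fi fE]; have mfe : measurable_fun setT (EFin \o f) by exact/measurable_EFinP.
split; last by rewrite (@integral_distribution _ _ _ _ _ _ _ (EFin \o f)).
exact: (@integrable_pushforward _ _ _ _ _ _ _ P setT).
Qed.

(** [g] and [g'] are the partial means of [f] and of its absolute value; the
    latter witnesses integrability on the product. *)
Lemma is_mean_fubini d d' (T : measurableType d) (T' : measurableType d')
    (R : realType) (P : probability T R) (Q : probability T' R)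
    (f : T * T' -> R) (g g' : T -> R) c c' :
    measurable_fun setT f ->
    (forall x, is_mean Q (fun y => f (x, y)) (g x)) ->
    (forall x, is_mean Q (fun y => `|f (x, y)|) (g' x)) ->
    is_mean P g c -> is_mean P g' c' -> is_mean (P \x Q)%E f c.
Proof.
move=> mf fg fg' gc gc'; have mfe : measurable_fun setT (EFin \o f) by exact/measurable_EFinP.
have fi : (P \x Q)%E.-integrable setT (EFin \o f).
  apply/(@integrable12ltyP _ _ _ _ _ P Q) => //=.
  under eq_integral do rewrite (fg' _).2.
  by rewrite gc'.2 ltry.
split=> //; rewrite -(@integral12_prod_meas1 _ _ _ _ _ P Q)// /fubini_F /=.
by under eq_integral do rewrite (fg _).2; rewrite gc.2.
Qed.

Section products.
Context d (T : measurableType d) (R : realType).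

Lemma is_mean_prod n (mu : 'I_n -> probability T R) (g : 'I_n -> T -> R) (c : 'I_n -> R) :
    (forall i, is_mean (mu i) (g i) (c i)) ->
  is_mean (prod_prob mu) (fun z => \prod_i g i (tnth z i)) (\prod_i c i).
Proof.
elim: n mu g c => [|n IH] mu g c h.
  rewrite big_ord0 (_ : (fun z => _) = cst 1); last by apply/funext => z; rewrite big_ord0.
  split; first exact: finite_measure_integrable_cst.
  by rewrite (integral_cst _ _ 1%:E)//= diracT mule1.
have h0 := h ord0; have h1 := IH _ _ _ (fun i => h (lift ord0 i)).
set P0 := mu ord0 in h0. set P1 := prod_prob _ in h1.
set f0 := g ord0 in h0. set f1 : n.-tuple T -> R := (f in is_mean _ f) in h1.
set F := fun z => _.
have mF : measurable_fun setT F.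
  apply: measurable_prod => i _.
  by apply: measurableT_comp (measurable_tnth i); exact: is_mean_measurable (h i).
have m0 := is_mean_measurable h0; have m1 := is_mean_measurable h1.
have FE z : F (cons_pair z) = f0 z.1 * f1 z.2.
  rewrite /F /f1 big_ord_recl; congr (_ * _).
  by apply: eq_bigr => i _; rewrite /cons_pair tnthS.
apply: is_mean_distribution => //.
apply: (is_mean_ext (f := fun z => f0 z.1 * f1 z.2)) => [z|]; first exact: (esym (FE z)).
have /integrable_is_mean h0' := integrable_norm h0.1.
have /integrable_is_mean h1' := integrable_norm h1.1.
rewrite big_ord_recl mulrC.
apply: (is_mean_fubini (g := fun x => (\prod_(i < n) c (lift ord0 i)) * f0 x)
  (g' := fun x => (\int[P1]_y `|f1 y|) * `|f0 x|)).
- apply: measurable_funM.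
    exact: measurableT_comp m0 measurable_fst.
  exact: measurableT_comp m1 measurable_snd.
- by move=> x; rewrite mulrC; exact: (is_meanZ (f0 x) h1).
- move=> x; rewrite mulrC; apply: is_mean_ext (is_meanZ `|f0 x| h1') => y.
  by rewrite normrM.
- exact: is_meanZ.
- exact: is_meanZ h0'.
Qed.

End products.

(** * Finitely supported laws and their powers *)

Section finite_law.
Context d (T : measurableType d) (R : realType).

(** [P] is the law of [v i] for an index [i] drawn with probability [w i]; the
    values [v i] need not be distinct. *)
Definition finite_law (P : probability T R) (I : finType) (w : I -> R) (v : I -> T) :=
  (forall i, 0 <= w i) /\
  forall f : T -> \bar R, (forall x, 0 <= f x)%E -> measurable_fun setT f ->
    (\int[P]_x f x = \sum_i (w i)%:E * f (v i))%E.

Variables (P : probability T R) (I : finType) (w : I -> R) (v : I -> T).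
Hypothesis Pwv : finite_law P w v.

Lemma finite_law_is_mean (f : T -> R) : measurable_fun setT f ->
  is_mean P f (\sum_i w i * f (v i)).
Proof.
move=> mf; have mfe : measurable_fun setT (EFin \o f) by exact/measurable_EFinP.
have [w0 PE] := Pwv; split.
  apply/integrableP; split=> //; rewrite PE//=; last by do 2?apply: measurableT_comp.
  by under eq_bigr do rewrite -EFinM; rewrite sumEFin ltry.
rewrite integralE !PE//; last 2 first.
- exact: measurable_funeneg.
- exact: measurable_funepos.
under eq_bigr do rewrite funeposE /= -EFin_max -EFinM.
under [X in (_ - X)%E]eq_bigr do rewrite funenegE /= -?EFinN -EFin_max -EFinM.
rewrite !sumEFin -EFinB -sumrB; congr EFin; apply: eq_bigr => i _.
by rewrite -mulrBr; congr (_ * _); case: (leP (f (v i)) 0) => h;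
  case: (leP (- f (v i)) 0) => h'; lra.
Qed.

(** Averaging over a finitely supported first coordinate: it suffices to know the
    mean of every section of [f], evaluated at the atoms. *)
Lemma finite_law_fubini d' (T' : measurableType d') (Q : probability T' R)
    (f : T * T' -> R) (g : T -> R) :
    measurable_fun setT f ->
    (forall x, is_mean Q (fun y => f (x, y)) (g x)) ->
  is_mean (P \x Q)%E f (\sum_i w i * g (v i)).
Proof.
move=> mf fg; have mfe : measurable_fun setT (EFin \o f) by exact/measurable_EFinP.
pose g' x := \int[Q]_y `|f (x, y)|.
have fg' x : is_mean Q (fun y => `|f (x, y)|) (g' x).
  exact/integrable_is_mean/integrable_norm/(fg x).1.
have mg' : measurable_fun setT g'.
  apply/measurable_EFinP.
  rewrite (_ : _ \o _ = fun x => (\int[Q]_y `|(f (x, y))%:E|)%E).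
    apply: (@measurable_fun_fubini_tonelli_F _ _ _ _ _ Q (fun z => `|(f z)%:E|%E)) => //.
    exact: measurableT_comp.
  by apply/funext => x /=; rewrite (fg' x).2.
have fi : (P \x Q)%E.-integrable setT (EFin \o f).
  apply/(@integrable12ltyP _ _ _ _ _ P Q) => //=.
  under eq_integral do rewrite (fg' _).2.
  by rewrite (finite_law_is_mean mg').2 ltry.
have mg : measurable_fun setT g.
  apply/measurable_EFinP.
  rewrite (_ : _ \o _ = fubini_F Q (EFin \o f)).
    exact: measurable_fubini_F fi.
  by apply/funext => x; rewrite /fubini_F /= (fg x).2.
apply: is_mean_fubini mf fg fg' _ _; exact: finite_law_is_mean.
Qed.

End finite_law.

(** Words of length [n] over [I], as iterated pairs; they index the atoms of the
    [n]-th power of a law whose atoms are indexed by [I]. *)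
Fixpoint words (I : finType) n : finType :=
  if n is m.+1 then (I * words I m)%type else unit.

Section finite_law_power.
Context d (T : measurableType d) (R : realType).
Variables (I : finType) (w : I -> R) (v : I -> T).

(** Product of the weights of the letters. *)
Fixpoint word_weight n : words I n -> R :=
  if n is m.+1 then fun u => w u.1 * word_weight u.2 else fun=> 1.

(** Tuple of the values of the letters. *)
Fixpoint word_value n : words I n -> n.-tuple T :=
  if n is m.+1 then fun u => [tuple of v u.1 :: word_value u.2] else fun=> [tuple].

Lemma finite_law_power (P : probability T R) n : finite_law P w v ->
  finite_law (prod_prob (fun _ : 'I_n => P)) (@word_weight n) (@word_value n).
Proof.
move=> [w0 PE]; elim: n => [|n [IHw IH]].
  split=> [i|f f0 mf]; first by rewrite /= ler01.
  by rewrite /= integral_dirac// diracT mul1e (big_pred1 tt) ?mul1e//; case.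
split=> [[i u]|f f0 mf]; first by rewrite /= mulr_ge0.
have mfc : measurable_fun setT (f \o @cons_pair _ T n).
  by apply: measurableT_comp => //; exact: measurable_cons_pair.
rewrite [LHS]ge0_integral_distribution//.
set Q := prod_prob _ in IH *.
rewrite (@fubini_tonelli1 _ _ _ _ _ P Q)//; last by move=> z; exact: f0.
rewrite PE//; last 2 first.
- by move=> x; rewrite /fubini_F; apply: integral_ge0 => y _; exact: f0.
- apply: (@measurable_fun_fubini_tonelli_F _ _ _ _ _ Q (f \o @cons_pair _ T n)) => //.
  by move=> z; exact: f0.
transitivity (\sum_i \sum_u (w i * word_weight u)%:E * f (cons_pair (v i, word_value u)))%E.
  apply: eq_bigr => i _; rewrite /fubini_F IH//=; last first.
    exact: (measurableT_comp mfc (pair1_measurable _)).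
  rewrite ge0_sume_distrr//; last by move=> u _; rewrite mule_ge0 ?lee_fin.
  by apply: eq_bigr => u _; rewrite muleA EFinM.
by rewrite pair_big.
Qed.

Lemma sum_word_weight_prod n (g : 'I_n -> T -> R) :
  \sum_(u : words I n) word_weight u * \prod_i g i (tnth (word_value u) i) =
  \prod_i \sum_j w j * g i (v j).
Proof.
elim: n g => [|n IH] g.
  by rewrite big_ord0 (big_pred1 tt) ?big_ord0 ?mul1r//; case.
rewrite big_ord_recl -(IH (fun i => g (lift ord0 i))).
rewrite big_distrlr /= pair_big /=; apply: eq_bigr => -[i u] _ /=.
rewrite big_ord_recl mulrACA; congr (_ * (_ * _)).
by apply: eq_bigr => k _; rewrite tnthS.
Qed.

Lemma sum_word_weight n : \sum_i w i = 1 -> \sum_(u : words I n) word_weight u = 1.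
Proof.
move=> w1; transitivity (\prod_(i < n) \sum_j w j * (fun=> 1) (v j)).
  rewrite -(sum_word_weight_prod (fun _ _ => 1)).
  by apply: eq_bigr => u _; rewrite big1_eq mulr1.
by apply: big1 => i _; rewrite -[RHS]w1; apply: eq_bigr => j _; rewrite mulr1.
Qed.

End finite_law_power.

Section rademacher_atoms.
Context (R : realType) (n : nat) (rho : R).

(** Atoms of one entry of the sparse Rademacher vector: the two signs and zero. *)
Definition rademacher_weight (i : 'I_3) : R := [:: rho / 2; rho / 2; 1 - rho]`_i.

Definition rademacher_value (i : 'I_3) : R :=
  [:: (Num.sqrt (rho * n%:R))^-1; - (Num.sqrt (rho * n%:R))^-1; 0]`_i.

Lemma finite_law_sparse_rademacher_entry : 0 < rho <= 1 ->
  finite_law (sparse_rademacher_entry n rho) rademacher_weight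
    (rademacher_value : _ -> measurableTypeR R).
Proof.
move=> /andP[r0 r1]; have h2 : 0 <= rho / 2 by rewrite divr_ge0// ltW.
have h3 : 0 <= 1 - rho by rewrite subr_ge0.
split=> [i|f f0 mf]; first by case: i => -[|[|[|]]].
pose a : measurableTypeR R := (Num.sqrt (rho * n%:R))^-1.
pose m := measure_add (measure_add (mscale (NngNum h2) \d_a)
  (mscale (NngNum h2) \d_(- a : measurableTypeR R)))
  (mscale (NngNum h3) \d_(0 : measurableTypeR R)).
transitivity (\int[m]_x f x)%E.
  apply: eq_measure_integral => A mA _.
  rewrite [in LHS]/= /sparse_rademacher_entry (ltW r0) r1.
  by rewrite /= /msum big_ord_recr/= big_ord1 /= /msum big_ord_recr/= big_ord1.
rewrite !ge0_integral_measure_add// !ge0_integral_mscale// !integral_dirac//.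
by rewrite !diracT !mul1e !big_ord_recr big_ord0 /= add0e.
Qed.

End rademacher_atoms.

(** * Gaussian means of polynomials *)

Section poly_analysis.
Context (R : realType).
Implicit Types (p : {poly R}) (x c : R).

Lemma is_derive_horner p x : is_derive x 1 (horner p) p^`().[x].
Proof.
elim/poly_ind: p => [|p a IH].
  rewrite (_ : horner 0 = cst 0); last by apply/funext => y; rewrite horner0.
  by rewrite deriv0 horner0; exact: is_derive_cst.
rewrite (_ : horner _ = (fun y => p.[y] * y + a)); last first.
  by apply/funext => y; rewrite !hornerE.
rewrite derivD derivM derivX derivC addr0 mulr1 hornerD hornerMX.
have -> : p^`().[x] * x + p.[x] = p.[x] *: 1 + x *: p^`().[x] + 0.
  by rewrite addr0 addrC /GRing.scale /= mulr1 mulrC.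
apply: is_deriveD.
Qed.

Lemma measurable_horner p : measurable_fun setT (horner p).
Proof. by apply: continuous_measurable_fun; exact: continuous_horner. Qed.

Lemma poly_le_expR_sqr p c : 0 < c ->
  exists2 C : R, 0 <= C & forall x, `|p.[x]| <= C * expR (c * x ^+ 2).
Proof.
elim/poly_ind: p c => [|p a IH] c c0.
  by exists 0 => // x; rewrite horner0 normr0 mul0r.
have c20 : 0 < c / 2 by rewrite divr_gt0.
have [C C0 HC] := IH _ c20.
exists (C * (1 + 2 / c) + `|a|).
  by rewrite addr_ge0 ?mulr_ge0 ?addr_ge0 ?divr_ge0// ltW.
move=> x; rewrite hornerMXaddC (le_trans (ler_normD _ _))// mulrDl lerD//; last first.
  by rewrite ler_peMr// -expR0 ler_expR mulr_ge0 ?sqr_ge0// ltW.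
have -> : c * x ^+ 2 = c / 2 * x ^+ 2 + c / 2 * x ^+ 2 by rewrite -mulrDl -splitr.
rewrite normrM expRD mulrACA ler_pM//.
have h1 : `|x| <= 1 + x ^+ 2.
  rewrite -real_normK ?num_real//; have := normr_ge0 x; set y := `|x| => y0; nra.
rewrite (le_trans h1)//.
rewrite (@le_trans _ _ ((1 + 2 / c) * (1 + c / 2 * x ^+ 2)))//; last first.
  by rewrite ler_wpM2l ?expR_ge1Dx ?addr_ge0 ?divr_ge0 ?ltW.
have h2 : (1 + 2 / c) * (1 + c / 2 * x ^+ 2) = 1 + x ^+ 2 + (2 / c + c / 2 * x ^+ 2).
  by field; rewrite gt_eqF.
by rewrite h2 lerDl addr_ge0 ?divr_ge0 ?(ltW c0) ?(mulr_ge0 (ltW c20) (sqr_ge0 _)).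
Qed.

End poly_analysis.

Section gaussian_moments.
Context (R : realType) (s : R).
Hypothesis s0 : s != 0.
Notation mu := (@lebesgue_measure R).
Notation phi := (normal_pdf 0 s).
Implicit Types (p g : {poly R}) (x t : R).

Let s20 : 0 < s ^+ 2. Proof. by rewrite exprn_even_gt0//= s0. Qed.

Let normal_pdf_expR t x : t != 0 ->
  normal_pdf 0 t x = normal_peak t * expR (- x ^+ 2 / (t ^+ 2 *+ 2)).
Proof. by move=> t0; rewrite normal_pdfE// /normal_fun subr0. Qed.

Lemma horner_normal_pdf_decay p : exists2 C : R, 0 <= C &
  forall x, `|p.[x] * phi x| <= C * expR (- x ^+ 2 / (s ^+ 2 *+ 4)).
Proof.
have c0 : 0 < (s ^+ 2 *+ 4)^-1 by rewrite invr_gt0 pmulrn_lgt0.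
have [C C0 HC] := poly_le_expR_sqr p c0.
exists (C * normal_peak s); first by rewrite mulr_ge0// normal_peak_ge0.
move=> x; rewrite normrM (ger0_norm (normal_pdf_ge0 _ _ _)) normal_pdf_expR//.
rewrite (le_trans (ler_wpM2r _ (HC x))) ?mulr_ge0 ?normal_peak_ge0 ?expR_ge0//.
rewrite mulrACA -expRD ler_wpM2l ?mulr_ge0 ?normal_peak_ge0// ler_expR.
rewrite le_eqVlt; apply/orP; left; apply/eqP.
by rewrite -!(mulr_natr (s ^+ 2)); field.
Qed.

Lemma integrable_horner_normal_pdf p :
  mu.-integrable setT (fun x => (p.[x] * phi x)%:E).
Proof.
have [C C0 HC] := horner_normal_pdf_decay p.
pose t := Num.sqrt 2 * s.
have t0 : t != 0 by rewrite mulf_neq0// sqrtr_eq0 -ltNge.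
have tE : t ^+ 2 *+ 2 = s ^+ 2 *+ 4.
  by rewrite exprMn sqr_sqrtr//; ring.
have := @integrableZl _ _ _ mu setT measurableT (C / normal_peak t) _ (integrable_normal_pdf 0 t).
apply: le_integrable => //.
  apply/measurable_EFinP/measurable_funM; first exact: measurable_horner.
  exact: measurable_normal_pdf.
move=> x _; rewrite -EFinM !abse_EFin lee_fin (le_trans (HC x))// ler_normr.
apply/orP; left; rewrite normal_pdf_expR// tE mulrA divfK//.
by rewrite gt_eqF// normal_peak_gt0.
Qed.

(** Mean of the polynomial [p] under the centered normal law of deviation [s]. *)
Definition gauss_mean p : R := \int[mu]_x (p.[x] * phi x).
Lemma is_mean_normal_horner p :
  is_mean (normal_prob 0 s) (horner p) (gauss_mean p).
Proof.
apply: (@density_is_mean _ _ _ _ mu phi) => //.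
- exact: measurable_normal_pdf.
- exact: normal_pdf_ge0.
- exact: measurable_horner.
- exact/integrable_is_mean/integrable_horner_normal_pdf.
Qed.

Let is_derive_congr (f g : R -> R) (a b x : R) :
  f =1 g -> a = b -> is_derive x 1 f a -> is_derive x 1 g b.
Proof. by move=> /funext -> ->. Qed.

Lemma is_derive_horner_normal_pdf p x :
  is_derive x 1 (fun y => p.[y] * phi y) ((p^`() - (s ^+ 2)^-1 *: ('X * p)).[x] * phi x).
Proof.
have D1 : is_derive x 1 phi (- (x / s ^+ 2) * phi x).
  rewrite normal_pdf_expR//.
  rewrite (_ : phi = (fun y => normal_peak s * expR (- y ^+ 2 / (s ^+ 2 *+ 2)))); last first.
    by apply/funext => y; rewrite normal_pdf_expR.
  have E1 : is_derive x 1 (fun y => - y ^+ 2 / (s ^+ 2 *+ 2)) (- (x / s ^+ 2)).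
    have := is_derive_horner (- (s ^+ 2 *+ 2)^-1 *: 'X^2) x.
    rewrite (_ : horner _ = (fun y => - y ^+ 2 / (s ^+ 2 *+ 2))); last first.
      by apply/funext => y; rewrite hornerZ hornerXn mulNr mulrC mulNr.
    move=> h; apply: is_derive_eq.
    by rewrite derivZ derivXn hornerZ hornerMn hornerXn /= expr1; field.
  have E2 := is_derive1_comp (is_derive_expR _) E1.
  have := is_deriveZ (normal_peak s) E2.
  by apply: is_derive_congr => //; rewrite /GRing.scale /=; ring.
have D2 := is_derive_horner p x.
have := is_deriveM D2 D1.
apply: is_derive_congr => //.
rewrite /GRing.scale /= hornerD hornerN hornerZ hornerM hornerX.
by field.
Qed.

(** The integrand is the derivative of [p phi], so its integral over [-n, n] is a
    boundary term, which vanishes in the limit. *)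
Lemma stein_zero p : gauss_mean (p^`() - (s ^+ 2)^-1 *: ('X * p)) = 0.
Proof.
set q := _ - _.
pose F x := p.[x] * phi x.
pose f x := q.[x] * phi x.
have dF x : is_derive x 1 F (f x) by exact: is_derive_horner_normal_pdf.
have cF : continuous F by move=> x; apply: differentiable_continuous; apply/derivable1_diffP.
have cf : continuous f.
  move=> x; apply: cvgM; first exact: continuous_horner.
  exact: continuous_normal_pdf.
have fi : mu.-integrable setT (EFin \o f) by exact: integrable_horner_normal_pdf.
pose I n := `[- n.+1%:R, n.+1%:R : R]%classic.
have h1 : (\int[mu]_x ((EFin \o f) \_ (I n)) x)%E @[n --> \oo] --> (\int[mu]_x (f x)%:E)%E.
  apply: (@dominated_cvg _ _ _ mu setT measurableT _ _ (fun x => `|(f x)%:E|)%E).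
  - move=> n; apply/(measurable_restrictT (D := I n) (EFin \o f)).
      exact: measurable_itv.
    by apply: measurable_funTS; have /integrableP[] := fi.
  - move=> x _; apply: cvg_near_cst; near=> n.
    rewrite /patch mem_set// /I /= in_itv/= -ler_norml.
    near: n; apply: filterS (nbhs_infty_ger `|x|) => n /le_trans; apply.
    by rewrite ler_nat.
  - by move=> x _.
  - exact: integrable_abse fi.
  - by move=> n x _; rewrite /patch; case: ifPn => //; rewrite abse0.
have h2 n : (\int[mu]_x ((EFin \o f) \_ (I n)) x = (F n.+1%:R - F (- n.+1%:R))%:E)%E.
  rewrite -integral_mkcond (@continuous_FTC2 _ f F)//.
  - by rewrite gtrN ?ltr0n.
  - exact: continuous_subspaceT.
  - split=> [x _||].
    + exact: ex_derive.
    + by apply: cvg_at_right_filter; exact: cF.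
    + by apply: cvg_at_left_filter; exact: cF.
  - by move=> x _; rewrite derive1E derive_val.
have h3 : F n.+1%:R - F (- n.+1%:R) @[n --> \oo] --> (0 : R).
  have [C C0 HC] := horner_normal_pdf_decay p.
  pose K := C * (s ^+ 2 *+ 4).
  have HF x : x != 0 -> `|F x| <= K / x ^+ 2.
    move=> x0; rewrite (le_trans (HC x))// /K -mulrA ler_wpM2l//.
    have y0 : 0 < x ^+ 2 / (s ^+ 2 *+ 4).
      by rewrite divr_gt0 ?pmulrn_lgt0// exprn_even_gt0//= x0.
    rewrite mulNr expRN -[leRHS]invrK invf_div lef_pV2 ?posrE ?expR_gt0//.
    by rewrite (le_trans _ (expR_ge1Dx _))// lerDr.
  have cK : K *+ 2 * harmonic n @[n --> \oo] --> (0 : R).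
    by rewrite -(mulr0 (K *+ 2)); apply: cvgMr => //; exact: cvg_harmonic.
  apply: (@squeeze_cvgr _ _ _ _ (fun n => - (K *+ 2 * harmonic n))
    (fun n => K *+ 2 * harmonic n)) => //; last first.
    by rewrite -oppr0; exact: cvgN.
  apply: nearW => n; rewrite -ler_norml (le_trans (ler_normB _ _))//.
  have n0 : n.+1%:R != 0 :> R by rewrite pnatr_eq0.
  have h : K / n.+1%:R ^+ 2 <= K * harmonic n.
    rewrite ler_wpM2l//; first by rewrite mulr_ge0// mulrn_wge0// ltW.
    by rewrite /harmonic /= lef_pV2 ?posrE ?exprn_gt0// expr2 ler_peMr// ler1n.
  rewrite mulrnAl mulr2n lerD// (le_trans (HF _ _))// ?oppr_eq0//.
  by rewrite sqrrN.
apply: EFin_inj.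
rewrite /gauss_mean /Rintegral fineK; last exact: integrable_fin_num.
rewrite -(cvg_lim _ h1)//; apply/cvg_lim => //.
under eq_fun do rewrite h2.
by apply: cvg_EFin => //; exact: nearW.
Unshelve. all: by end_near.
Qed.

Lemma gauss_mean1 : gauss_mean 1 = 1.
Proof.
apply: EFin_inj; rewrite -[RHS](integral_normal_pdf 0 s).
rewrite /gauss_mean /Rintegral fineK; last first.
  by apply: integrable_fin_num => //; exact: integrable_horner_normal_pdf.
by apply: eq_integral => x _; rewrite hornerC mul1r.
Qed.

Lemma gauss_meanD p g : gauss_mean (p + g) = gauss_mean p + gauss_mean g.
Proof.
apply: is_mean_uniq (is_mean_normal_horner _) _.
apply: is_mean_ext (is_meanD (is_mean_normal_horner p) (is_mean_normal_horner g)) => x.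
by rewrite hornerD.
Qed.

Lemma gauss_meanZ c p : gauss_mean (c *: p) = c * gauss_mean p.
Proof.
apply: is_mean_uniq (is_mean_normal_horner _) _.
apply: is_mean_ext (is_meanZ c (is_mean_normal_horner p)) => x.
by rewrite hornerZ.
Qed.

Lemma gauss_mean0 : gauss_mean 0 = 0.
Proof. by rewrite -(scale0r 0) gauss_meanZ mul0r. Qed.

Lemma gauss_meanB p g : gauss_mean (p - g) = gauss_mean p - gauss_mean g.
Proof. by rewrite -scaleN1r gauss_meanD gauss_meanZ mulN1r. Qed.

(** Gaussian integration by parts. *)
Lemma stein p : gauss_mean ('X * p) = s ^+ 2 * gauss_mean p^`().
Proof.
have := stein_zero p; rewrite gauss_meanB gauss_meanZ => /eqP.
rewrite subr_eq0 => /eqP ->; rewrite mulrA divff ?mul1r//.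
by rewrite expf_neq0.
Qed.

(** Monic Hermite polynomials for the variance [s ^+ 2]. *)
Fixpoint hermite n : {poly R} :=
  if n is m.+1 then 'X * hermite m - s ^+ 2 *: (hermite m)^`() else 1.

Lemma gauss_mean_hermiteM n p :
  gauss_mean (hermite n * p) = s ^+ (2 * n) * gauss_mean p^`(n).
Proof.
elim: n p => [|n IH] p; first by rewrite /= mul1r muln0 expr0 mul1r.
rewrite /= mulrBl gauss_meanB -mulrA stein derivM gauss_meanD -[_ *: _ * p]scalerAl gauss_meanZ.
rewrite mulrDr addrAC subrr add0r IH -derivSn -derivnS.
by rewrite mulrA -exprD mulnS.
Qed.

Lemma deriv_hermite n : (hermite n.+1)^`() = hermite n *+ n.+1.
Proof.
elim: n => [|n IH].
  by rewrite /= derivB derivM derivZ -[1]/(1%:P) derivC derivX deriv0 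
    !(mulr0, scaler0, addr0, subr0) mul1r.
rewrite [hermite n.+2]/= derivB derivM derivX mul1r derivZ IH derivMn.
by rewrite mulrnAr -scalerMnr -addrA -mulrnBl -/(hermite n.+1) -mulrS.
Qed.

Lemma derivn_hermite m n : (hermite n)^`(m) = hermite (n - m) *+ n ^_ m.
Proof.
elim: m n => [|m IH] n; first by rewrite subn0 ffactn0 derivn0.
case: n => [|n]; first by rewrite -[hermite 0]/(1%:P) derivnC ffact0n.
by rewrite derivSn deriv_hermite derivnMn IH subSS -mulrnA ffactSS mulnC.
Qed.

(** Hermite polynomials normalized so that pairing with [hermite_dual n] extracts
    the mean of the [n]-th Taylor coefficient. *)
Definition hermite_dual n : {poly R} := (s ^+ (2 * n) * n`!%:R)^-1 *: hermite n.

Lemma gauss_mean_dualM n p : gauss_mean (hermite_dual n * p) = gauss_mean p^`N(n).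
Proof.
rewrite /hermite_dual -scalerAl gauss_meanZ gauss_mean_hermiteM nderivn_def.
rewrite -(scaler_nat _ p^`N(n)) gauss_meanZ.
by field; rewrite ?s0 expf_neq0 ?pnatr_eq0 -?lt0n ?fact_gt0.
Qed.

Lemma gauss_mean_hermite n : gauss_mean (hermite n) = (n == 0%N)%:R.
Proof.
rewrite -[hermite n]mulr1 gauss_mean_hermiteM.
case: n => [|n]; first by rewrite derivn0 gauss_mean1 muln0 mul1r.
by rewrite -[1]/(1%:P) derivnC gauss_mean0 mulr0.
Qed.

Lemma gauss_mean_dual_dual m n : gauss_mean (hermite_dual m * hermite_dual n) =
  if m == n then (s ^+ (2 * n) * n`!%:R)^-1 else 0.
Proof.
rewrite /hermite_dual -scalerAl -scalerAr !gauss_meanZ gauss_mean_hermiteM derivn_hermite.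
rewrite -(scaler_nat _ (hermite (n - m))) gauss_meanZ gauss_mean_hermite.
have sn0 k : s ^+ (2 * k) * k`!%:R != 0.
  by rewrite mulf_neq0 ?expf_neq0 ?pnatr_eq0 -?lt0n ?fact_gt0.
case: ifPn => [/eqP ->|mn].
  rewrite subnn ffactnn mulr1 [X in _ * (_ * X)](_ : _ = s ^+ (2 * n) * n`!%:R)//.
  by rewrite mulVf ?mulr1.
have [nm|nm] := ltnP n m; first by rewrite ffact_small// mul0r !mulr0.
by rewrite subn_eq0 leqNgt ltn_neqAle mn nm mulr0 !mulr0.
Qed.

Lemma is_mean_normal_shift p c n : (size p <= n)%N ->
  is_mean (normal_prob 0 s) (fun x => p.[x + c])
    (\sum_(i < n) c ^+ i * gauss_mean p^`N(i)).
Proof.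
move=> pn.
have H : is_mean (normal_prob 0 s) (fun x => \sum_(i < n) c ^+ i * p^`N(i).[x])
    (\sum_(i < n) c ^+ i * gauss_mean p^`N(i)).
  by apply: is_mean_sum => i _; apply: is_meanZ; exact: is_mean_normal_horner.
apply: is_mean_ext H => x; rewrite (nderiv_taylor_wide _ pn); last exact: mulrC.
by apply: eq_bigr => i _; rewrite mulrC.
Qed.

End gaussian_moments.

(** * Projection of a Gaussian mixture *)

Section truncated_exponential.
Context (R : realFieldType).
Implicit Types (a b : R).

(* Exponential series truncated at degree D, as a polynomial in a formal variable
     that records the degree. *)
Let texp D a : {poly R} := \poly_(i < D.+1) (a ^+ i / i`!%:R).

Let exp_coefD a b n :
  \sum_(i < n.+1) (a ^+ i / i`!%:R) * (b ^+ (n - i) / (n - i)`!%:R) =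
  (a + b) ^+ n / n`!%:R.
Proof.
have f0 m : m`!%:R != 0 :> R by rewrite pnatr_eq0 -lt0n fact_gt0.
rewrite addrC exprDn mulr_suml; apply: eq_bigr => i _.
rewrite -(bin_fact (ltn_ord i : i <= n)%N) !natrM -mulr_natr.
have := f0 i; have := f0 (n - i)%N => h1 h2.
have h3 : 'C(n, i)%:R != 0 :> R by rewrite pnatr_eq0 -lt0n bin_gt0 -ltnS.
by field; rewrite h1 h2 h3.
Qed.

Let coef_prod_texp D (I : Type) (r : seq I) (a : I -> R) d : (d <= D)%N ->
  (\prod_(k <- r) texp D (a k))`_d = (\sum_(k <- r) a k) ^+ d / d`!%:R.
Proof.
elim: r d => [|k r IH] d dD.
  rewrite !big_nil coef1 expr0n; case: d dD => [|d] _ /=.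
    by rewrite fact0 divr1.
  by rewrite mul0r.
rewrite !big_cons -exp_coefD coefM; apply: eq_bigr => i _.
have iD : (i <= D)%N by rewrite (leq_trans _ dD)// -ltnS.
by rewrite coef_poly ltnS iD IH// (leq_trans (leq_subr _ _)).
Qed.

(** The multinomial theorem summed over all degrees up to [D]. *)
Lemma sum_multinomial_expr D N (a : 'I_N -> R) :
  \sum_(al : {ffun 'I_N -> 'I_D.+1} | (\sum_k al k <= D)%N)
     \prod_k (a k ^+ al k / (al k)`!%:R) =
  \sum_(d < D.+1) (\sum_k a k) ^+ d / d`!%:R.
Proof.
have E : \prod_k texp D (a k) = \sum_(al : {ffun 'I_N -> 'I_D.+1})
    (\prod_k (a k ^+ al k / (al k)`!%:R)) *: 'X^(\sum_k al k).
  under eq_bigr do rewrite /texp poly_def.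
  rewrite bigA_distr_bigA; apply: eq_bigr => al _.
  by rewrite scaler_prod -expr_sum.
under [RHS]eq_bigr => d _.
  rewrite -(@coef_prod_texp D); last by rewrite -ltnS.
  rewrite E coef_sum; over.
rewrite exchange_big /= [LHS]big_mkcond; apply: eq_bigr => al _.
under [RHS]eq_bigr do rewrite coefZ coefXn.
case: ifPn => [h|h].
  rewrite (bigD1 (Ordinal (h : \sum_k al k < D.+1)%N))//= eqxx mulr1.
  rewrite [X in _ + X]big1 ?addr0// => d dn; rewrite (_ : (_ == _) = false) ?mulr0//.
  by apply: contraNF dn => /eqP dE; apply/eqP/val_inj.
rewrite big1// => d _; rewrite (_ : (_ == _) = false) ?mulr0//.
by apply: contraNF h => /eqP <-; rewrite -ltnS.
Qed.

End truncated_exponential.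

Section gaussian_mixture.
Context (R : realType) (N : nat) (sigma : 'I_N -> R).
Hypothesis sigma0 : forall k, sigma k != 0.
Notation TR := (measurableTypeR R).
Notation Q := (prod_prob (fun k => normal_prob 0 (sigma k))).
Implicit Types (Y : N.-tuple TR) (mu : 'I_N -> R).

(** Polynomial function given by a list of coefficients and exponents. *)
Definition peval (r : seq (R * ('I_N -> nat))) (v : 'I_N -> R) : R :=
  \sum_(j <- r) j.1 * \prod_k v k ^+ j.2 k.

Definition pdeg_le D (r : seq (R * ('I_N -> nat))) := all (fun j => \sum_k j.2 k <= D)%N r.

Lemma is_mean_prod_normal (p : 'I_N -> {poly R}) :
  is_mean Q (fun Y => \prod_k (p k).[tnth Y k]) (\prod_k gauss_mean (sigma k) (p k)).
Proof.
exact: (is_mean_prod (fun k => is_mean_normal_horner (sigma0 k) (p k))).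
Qed.

Lemma is_mean_prod_normal_shift (p : 'I_N -> {poly R}) mu D :
    (forall k, size (p k) <= D.+1)%N ->
  is_mean Q (fun Y => \prod_k (p k).[tnth Y k + mu k])
    (\sum_(al : {ffun 'I_N -> 'I_D.+1})
       \prod_k (mu k ^+ al k * gauss_mean (sigma k) (p k)^`N(al k))).
Proof.
move=> pD; rewrite -(bigA_distr_bigA (fun k (i : 'I_D.+1) => mu k ^+ i * gauss_mean (sigma k) (p k)^`N(i))).
exact: (is_mean_prod (fun k => is_mean_normal_shift (sigma0 k) (mu k) (pD k))).
Qed.

Variables (D : nat) (S : finType) (w : S -> R) (mu : S -> 'I_N -> R).

Let mix_moment (al : {ffun 'I_N -> 'I_D.+1}) : R :=
  \sum_s w s * \prod_k mu s k ^+ al k.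

(** Projection onto degree at most [D] of the density of the mixture
    with weights [w] of the translates of the Gaussian law by [mu]. *)
Definition mixture_projection Y : R :=
  \sum_(al : {ffun 'I_N -> 'I_D.+1} | (\sum_k al k <= D)%N)
    mix_moment al * \prod_k (hermite_dual (sigma k) (al k)).[tnth Y k].

(** Taylor expansion of the mean of a translated polynomial in the translation
    vector; the multi-indices of degree above [D] contribute nothing. *)
Lemma is_mean_mixture_peval r s : pdeg_le D r ->
  is_mean Q (fun Y => peval r (fun k => tnth Y k + mu s k))
    (\sum_(j <- r) j.1 * \sum_(al : {ffun 'I_N -> 'I_D.+1} | (\sum_k al k <= D)%N)
       \prod_k (mu s k ^+ al k * gauss_mean (sigma k) ('X^(j.2 k))^`N(al k))).
Proof.
elim: r => [|j r IH] /=.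
  by move=> _; rewrite /peval !big_nil; apply: is_mean_ext (is_mean0 _) => Y; rewrite big_nil.
move=> /andP[jD rD]; rewrite /peval big_cons.
have jDk k : (j.2 k <= D)%N.
  by rewrite (leq_trans _ jD)// (bigD1 k)//= leq_addr.
have pD k : (size ('X^(j.2 k) : {poly R}) <= D.+1)%N by rewrite size_polyXn ltnS.
have H := is_meanD (is_meanZ j.1 (is_mean_prod_normal_shift (mu s) pD)) (IH rD).
have -> : \sum_(al : {ffun 'I_N -> 'I_D.+1} | (\sum_k al k <= D)%N)
       \prod_k (mu s k ^+ al k * gauss_mean (sigma k) ('X^(j.2 k))^`N(al k)) =
    \sum_(al : {ffun 'I_N -> 'I_D.+1})
       \prod_k (mu s k ^+ al k * gauss_mean (sigma k) ('X^(j.2 k))^`N(al k)).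
  rewrite big_mkcond; apply: eq_bigr => al _; case: ifPn => // alD.
  have [k hk] : exists k, (j.2 k < al k)%N.
    apply/existsP; apply: contraR alD => /existsPn h.
    rewrite (leq_trans _ jD)// leq_sum// => k _.
    by rewrite leqNgt.
  rewrite (bigD1 k)//= nderivn_poly0 ?size_polyXn//.
  by rewrite gauss_mean0// mulr0 mul0r.
apply: is_mean_ext H => Y; rewrite [RHS]big_cons; congr (_ * _ + _).
by apply: eq_bigr => k _; rewrite hornerXn.
Qed.

(** The right-hand side is the mean of [peval r] under the mixture: against
    polynomials of degree at most [D], the projection acts as the density. *)
Lemma is_mean_peval_projection r : pdeg_le D r ->
  is_mean Q (fun Y => peval r (tnth Y) * mixture_projection Y)
    (\sum_s w s * \sum_(j <- r) j.1 *
      \sum_(al : {ffun 'I_N -> 'I_D.+1} | (\sum_k al k <= D)%N)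
       \prod_k (mu s k ^+ al k * gauss_mean (sigma k) ('X^(j.2 k))^`N(al k))).
Proof.
move=> rD.
have H j (al : {ffun 'I_N -> 'I_D.+1}) := is_mean_prod_normal (fun k => hermite_dual (sigma k) (al k) * 'X^(j k)).
have := is_mean_sum r (P := xpredT) (fun j _ => is_mean_sum
  (index_enum {ffun 'I_N -> 'I_D.+1})
  (P := fun al : {ffun 'I_N -> 'I_D.+1} => (\sum_k al k <= D)%N) (fun al _ => is_meanZ (j.1 * mix_moment al) (H j.2 al))).
rewrite [X in is_mean _ _ X -> _](_ : _ =  (\sum_s w s * \sum_(j <- r) j.1 *
      \sum_(al : {ffun 'I_N -> 'I_D.+1} | (\sum_k al k <= D)%N)
       \prod_k (mu s k ^+ al k * gauss_mean (sigma k) ('X^(j.2 k))^`N(al k)))).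
  apply: is_mean_ext => Y; rewrite /peval mulr_suml; apply: eq_bigr => j _.
  rewrite /mixture_projection [RHS]mulr_sumr; apply: eq_bigr => al _.
  rewrite mulrACA -big_split; congr (_ * _).
  by apply: eq_bigr => k _; rewrite hornerM hornerXn mulrC.
under [RHS]eq_bigr do rewrite mulr_sumr.
rewrite [RHS]exchange_big; apply: eq_bigr => j _ /=.
under [RHS]eq_bigr do rewrite mulrCA mulr_sumr.
rewrite -mulr_sumr [X in _ * X]exchange_big [RHS]mulr_sumr; apply: eq_bigr => al _ /=.
rewrite -mulrA; congr (_ * _); rewrite mulr_suml; apply: eq_bigr => s _.
rewrite -mulrA -big_split; congr (_ * _); apply: eq_bigr => k _ /=.
by rewrite gauss_mean_dualM.
Qed.

Lemma is_mean_projection_sqr :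
  is_mean Q (fun Y => mixture_projection Y ^+ 2)
    (\sum_s \sum_t w s * w t *
       \sum_(d < D.+1) (\sum_k mu s k * mu t k / sigma k ^+ 2) ^+ d / d`!%:R).
Proof.
have H (al be : {ffun 'I_N -> 'I_D.+1}) := is_mean_prod_normal
  (fun k => hermite_dual (sigma k) (al k) * hermite_dual (sigma k) (be k)).
have := is_mean_sum (index_enum {ffun 'I_N -> 'I_D.+1})
  (P := fun al : {ffun 'I_N -> 'I_D.+1} => (\sum_k al k <= D)%N) (fun al _ => is_mean_sum
  (index_enum {ffun 'I_N -> 'I_D.+1})
  (P := fun be : {ffun 'I_N -> 'I_D.+1} => (\sum_k be k <= D)%N)
  (fun be _ => is_meanZ (mix_moment al * mix_moment be) (H al be))).
rewrite [X in is_mean _ _ X -> _](_ : _ = \sum_s \sum_t w s * w t *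
       \sum_(d < D.+1) (\sum_k mu s k * mu t k / sigma k ^+ 2) ^+ d / d`!%:R).
  apply: is_mean_ext => Y; rewrite expr2 {1}/mixture_projection mulr_suml.
  apply: eq_bigr => al _; rewrite /mixture_projection [RHS]mulr_sumr; apply: eq_bigr => be _.
  rewrite mulrACA -big_split; congr (_ * _).
  by apply: eq_bigr => k _; rewrite hornerM.
transitivity (\sum_(al : {ffun 'I_N -> 'I_D.+1} | (\sum_k al k <= D)%N)
    mix_moment al ^+ 2 * \prod_k (sigma k ^+ (2 * al k) * (al k)`!%:R)^-1).
  apply: eq_bigr => al alD; rewrite (bigD1 al)//= [X in _ + X]big1 ?addr0 => [|be /andP[_ be_al]].
    by rewrite expr2; congr (_ * _); apply: eq_bigr => k _; rewrite gauss_mean_dual_dual// eqxx.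
  have [k hk] : exists k, al k != be k.
    apply/existsP; apply: contraR be_al => /existsPn h; apply/eqP/ffunP => k.
    by have := h k; rewrite negbK => /eqP.
  rewrite (bigD1 k)//= gauss_mean_dual_dual// ifN ?mul0r ?mulr0//.
under [RHS]eq_bigr => s _.
  under eq_bigr => t _ do rewrite -sum_multinomial_expr mulr_sumr.
  rewrite exchange_big; over.
rewrite exchange_big; apply: eq_bigr => al _ /=.
rewrite expr2 {1}/mix_moment !mulr_suml; apply: eq_bigr => s _.
rewrite mulrAC [LHS]mulr_sumr; apply: eq_bigr => t _.
have E (a b c d e : R) : a * b * c * (d * e) = a * d * (b * e * c) by ring.
rewrite E -!big_split /=; congr (_ * _); apply: eq_bigr => k _.
rewrite exprM invfM -exprVn !exprMn -exprVn.
by ring.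
Qed.

Lemma is_mean_peval_sqr r : exists a, is_mean Q (fun Y => peval r (tnth Y) ^+ 2) a.
Proof.
have H (j j' : R * ('I_N -> nat)) := is_mean_prod_normal (fun k => 'X^(j.2 k) * 'X^(j'.2 k)).
have := is_mean_sum r (P := xpredT) (fun j _ => is_mean_sum r
  (P := xpredT) (fun j' _ => is_meanZ (j.1 * j'.1) (H j j'))).
set a := (X in is_mean _ _ X) => Ha; exists a; apply: is_mean_ext Ha => Y.
rewrite expr2 {1}/peval mulr_suml; apply: eq_bigr => j _.
rewrite /peval [RHS]mulr_sumr; apply: eq_bigr => j' _.
rewrite mulrACA -big_split; congr (_ * _).
by apply: eq_bigr => k _; rewrite hornerM !hornerXn.
Qed.

(** If a polynomial of degree at most [D] has the same mean under the mixture
    as its square has under the Gaussian law, this common mean is at most the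
    squared norm of the degree-[D] projection of the likelihood ratio. *)
Lemma mixture_projection_bound r a (c : S -> R) : pdeg_le D r ->
    is_mean Q (fun Y => peval r (tnth Y) ^+ 2) a ->
    (forall s, is_mean Q (fun Y => peval r (fun k => tnth Y k + mu s k)) (c s)) ->
    a = \sum_s w s * c s ->
  a <= \sum_s \sum_t w s * w t *
       \sum_(d < D.+1) (\sum_k mu s k * mu t k / sigma k ^+ 2) ^+ d / d`!%:R.
Proof.
move=> rD Ha Hc aE; set K := (X in a <= X).
have H1 := is_mean_peval_projection rD.
rewrite [X in is_mean _ _ X](_ : _ = a) in H1; last first.
  rewrite aE; apply: eq_bigr => s _; congr (_ * _).
  exact: is_mean_uniq (is_mean_mixture_peval s rD) (Hc s).
have := is_meanD (is_meanB Ha (is_meanZ 2 H1)) is_mean_projection_sqr.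
rewrite -/K => /is_mean_ge0 h; rewrite -subr_ge0.
have -> : K - a = a - 2 * a + K by ring.
apply: h => Y; set x := peval _ _; set y := mixture_projection _.
have -> : x ^+ 2 - 2 * (x * y) + y ^+ 2 = (x - y) ^+ 2 by ring.
exact: sqr_ge0.
Qed.

End gaussian_mixture.

Lemma sum_upper (R : nmodType) n (F : 'I_n -> 'I_n -> R) :
  \sum_(k < #|upper n|) F (entry_row k) (entry_col k) =
  \sum_(i < n) \sum_(j < n | (i <= j)%N) F i j.
Proof.
transitivity (\sum_(u : upper n) F (val u).1 (val u).2).
  rewrite [RHS](reindex (fun k : 'I_#|upper n| => enum_val k))//=.
  by apply: onW_bij; exact: enum_val_bij.
rewrite pair_big_dep /= [RHS](reindex_omap (val : upper n -> _) insub); last first.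
  by move=> u hu; rewrite insubT.
by apply: eq_bigl => u; rewrite valK eqxx andbT (valP u).
Qed.

(** Diagonal entries have variance twice as large, which makes the weighted sum
    over the upper triangle a perfect square. *)
Lemma sum_upper_sqr (R : realFieldType) n (z : 'I_n -> R) :
  \sum_(k < #|upper n|) z (entry_row k) * z (entry_col k) /
    (if entry_row k == entry_col k then 2 else 1) = (\sum_i z i) ^+ 2 / 2.
Proof.
pose G i j := z i * z j / (if i == j then 2 else 1).
rewrite (sum_upper G).
have GC i j : G i j = G j i by rewrite /G eq_sym (mulrC (z i)).
have E : \sum_(i < n) \sum_(j < n | (i <= j)%N) G i j = \sum_(i < n) \sum_(j < n | (j <= i)%N) G i j.
  rewrite (exchange_big_dep xpredT)//=; apply: eq_bigr => j _.
  by apply: eq_bigr => i _; exact: GC.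
apply: (mulIf (x := 2)) => //.
rewrite divfK// mulr_natr mulr2n {2}E -big_split expr2 mulr_suml; apply: eq_bigr => i _ /=.
rewrite mulr_sumr (bigID (fun j : 'I_n => (i <= j)%N) xpredT)/=.
rewrite (bigD1 i (P := fun j : 'I_n => (i <= j)%N))//= [X in _ + X = _](bigD1 i)//=.
rewrite [X in _ = X + _](bigD1 i (P := fun j : 'I_n => (i <= j)%N))//=.
have Gii : G i i + G i i = z i * z i by rewrite /G eqxx -splitr.
rewrite addrACA Gii -addrA; congr (_ + _); congr (_ + _).
  by apply: eq_bigr => j /andP[_ ji]; rewrite /G eq_sym (negbTE ji) divr1.
apply: eq_big => [j|j /andP[_ ji]]; first by rewrite -ltnNge ltn_neqAle andbC.
by rewrite /G eq_sym (negbTE ji) divr1.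
Qed.

(** * The spiked Wigner model *)

Lemma polymx_eval_peval (R : realType) n D (p : polymx R n) : degree_le D p ->
  exists2 r, pdeg_le D r & forall Y : symmx R n, polymx_eval p Y = peval r (tnth Y).
Proof.
move=> pD.
exists [seq (mcoeff m p, fun k => fun_of_multinom m k) | m <- msupp p].
  rewrite /pdeg_le all_map; apply/allP => m mp /=.
  have := msize_mdeg_lt mp; rewrite mdegE => /leq_trans/(_ pD).
  by rewrite ltnS.
by move=> Y; rewrite /polymx_eval mevalE /peval [RHS]big_map.
Qed.

Section spiked_wigner_projection.
Context (R : realType) (n : nat) (lambda rho : R).
Hypotheses (n0 : (0 < n)%N) (rho01 : 0 < rho <= 1).
Notation TR := (measurableTypeR R).

Let word := words 'I_3 n.
Let weight : word -> R := word_weight (rademacher_weight rho) (n:=n).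
Let spike : word -> n.-tuple TR := word_value (rademacher_value n rho : 'I_3 -> TR) (n:=n).

Let sigma (k : 'I_#|upper n|) : R :=
  Num.sqrt ((if entry_row k == entry_col k then 2 else 1) / n%:R).

Let sigma_sqr k : sigma k ^+ 2 = (if entry_row k == entry_col k then 2 else 1) / n%:R.
Proof. by rewrite sqr_sqrtr// divr_ge0//; case: ifP. Qed.

Let sigma0 k : sigma k != 0.
Proof.
by rewrite -sqrf_eq0 sigma_sqr mulf_neq0 ?invr_eq0 ?pnatr_eq0 ?gtn_eqF//; case: ifP.
Qed.

Let shift (x : n.-tuple TR) (k : 'I_#|upper n|) : R :=
  lambda * (tnth x (entry_row k) * tnth x (entry_col k)).

Let overlap (u v : word) : R := \sum_i tnth (spike u) i * tnth (spike v) i.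

Let shift_dot u v : \sum_k shift (spike u) k * shift (spike v) k / sigma k ^+ 2 =
  lambda ^+ 2 * n%:R / 2 * overlap u v ^+ 2.
Proof.
rewrite mulrAC -mulrA -sum_upper_sqr mulr_sumr; apply: eq_bigr => k _.
rewrite sigma_sqr /shift.
have nn : n%:R != 0 :> R by rewrite pnatr_eq0 -lt0n.
by case: ifP => _; field.
Qed.

(** Truncated exponential series of degree [D], averaged over the overlap of two
    independent spikes: the squared norm of [mixture_projection] in this model. *)
Definition projection_sqr_norm (D : nat) : R :=
  \sum_(u : words 'I_3 n) \sum_(v : words 'I_3 n)
    word_weight (rademacher_weight rho) u * word_weight (rademacher_weight rho) v *
    \sum_(d < D.+1) (lambda ^+ 2 * n%:R / 2 *
      (\sum_i (tnth (word_value (rademacher_value n rho : 'I_3 -> TR) u) i) *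
              (tnth (word_value (rademacher_value n rho : 'I_3 -> TR) v) i)) ^+ 2) ^+ d / d`!%:R.

Lemma is_mean_spiked_wigner D r : pdeg_le D r ->
  exists2 c : word -> R,
    (forall u, is_mean (GOE n) (fun Y : symmx R n => peval r (fun k => tnth Y k + shift (spike u) k)) (c u)) &
    is_mean (spiked_wigner lambda (sparse_rademacher n rho))
      (fun Y : symmx R n => peval r (tnth Y)) (\sum_u weight u * c u).
Proof.
move=> rD.
pose g x := \int[GOE n]_Y peval r (fun k => tnth (Y : symmx R n) k + shift x k).
have Hg x : is_mean (GOE n) (fun Y : symmx R n => peval r (fun k => tnth Y k + shift x k)) (g x).
  apply: integrable_is_mean.
  exact: (is_mean_mixture_peval sigma0 (fun _ : unit => shift x) tt rD).1.
exists (fun u => g (spike u)) => //.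
have mp : measurable_fun setT (fun Y : symmx R n => peval r (tnth Y)).
  apply: measurable_sum => j; apply: measurable_funM => //.
  apply: measurable_prod => k _; apply: measurable_funX.
  exact: measurable_tnth.
apply: is_mean_distribution => //.
apply: finite_law_fubini.
- exact: (finite_law_power n (finite_law_sparse_rademacher_entry n rho01)).
- by apply: measurableT_comp => //; exact: measurable_add_spike.
- move=> x; apply: is_mean_ext (Hg x) => Y /=; congr peval.
  by apply/funext => k; rewrite /add_spike /= tnth_mktuple.
Qed.

Lemma low_degree_projection_bound D (L : symmx R n -> R) (p : polymx R n) :
    is_likelihood_ratio (spiked_wigner lambda (sparse_rademacher n rho)) (GOE n) L ->
    is_low_degree_projection (GOE n) D L p ->
  ('E_(GOE n)[(fun Y => polymx_eval p Y ^+ 2)%R] <= (projection_sqr_norm D)%:E)%E.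
Proof.
move=> [mL L0 PE] [pD pP].
have [r rD pr] := polymx_eval_peval pD.
have [a Ha] := is_mean_peval_sqr sigma0 r.
have [c Hc HP] := is_mean_spiked_wigner rD.
have HL := is_mean_density mL L0 PE HP.
have aE : a = \sum_u weight u * c u.
  have := is_meanB HL Ha; set b := _ - a => Hb.
  have := pP p pD; rewrite unlock => h0.
  apply/esym/eqP; rewrite -subr_eq0 -/b; apply/eqP; apply: EFin_inj.
  rewrite -[RHS]h0 -Hb.2; apply: eq_integral => Y _.
  by rewrite !pr; congr EFin; ring.
have -> : ('E_(GOE n)[(fun Y => polymx_eval p Y ^+ 2)%R] = a%:E)%E.
  by rewrite unlock -Ha.2; apply: eq_integral => Y _; rewrite /= pr.
rewrite lee_fin (le_trans (mixture_projection_bound sigma0 rD Ha Hc aE))//.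
rewrite le_eqVlt; apply/orP; left; apply/eqP.
apply: eq_bigr => u _; apply: eq_bigr => v _; congr (_ * _).
by apply: eq_bigr => d _; rewrite shift_dot.
Qed.

End spiked_wigner_projection.

(** * Elementary inequalities *)

Section elementary_bounds.
Context (R : realType).
Implicit Types (x t u q : R).

(** Even powers are dominated by the hyperbolic cosine, up to a factor 2. *)
Lemma expRDN_ge_pow x d : (0 < d)%N ->
  x ^+ (2 * d) / (2 * d)`!%:R <= expR x + expR (- x).
Proof.
move=> d0.
have H (y : R) : 0 <= y -> y ^+ (2 * d) / (2 * d)`!%:R <= expR y.
  move=> y0; have := expR_ge1Dxn (2 * d).-1 y0.
  rewrite prednK ?muln_gt0//; apply: le_trans; by rewrite lerDr.
have [x0|x0] := leP 0 x.
  by rewrite (le_trans (H _ x0))// lerDl expR_ge0.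
have := H (- x); rewrite exprM sqrrN -exprM => h.
by rewrite (le_trans (h _)) ?oppr_ge0 ?ltW// ltrDr expR_gt0.
Qed.

(** From the fourth-order term on, the Taylor series of the hyperbolic cosine is
    dominated by a geometric series of ratio 1/3, whose sum turns the factor 1/24
    into 1/16. *)
Lemma expRDN_le t : t ^+ 2 <= 2 -> expR t + expR (- t) <= 2 + t ^+ 2 + t ^+ 4 / 8.
Proof.
move=> t2.
have H k : \sum_(0 <= j < (2 * k)) (exp_coeff t j + exp_coeff (- t) j) <= 2 + t ^+ 2 + t ^+ 4 / 8.
  set u := t ^+ 2; have u0 : 0 <= u by exact: sqr_ge0.
  have E : \sum_(0 <= j < (2 * k)) (exp_coeff t j + exp_coeff (- t) j) =
      2 * \sum_(0 <= j < k) u ^+ j / (2 * j)`!%:R.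
    elim: k => [|k IH]; first by rewrite muln0 !big_geq ?mulr0.
    rewrite mulnS !addSn add0n 2?big_nat_recr//= big_nat_recr//= IH mulrDr -addrA; congr (_ + _).
    rewrite /exp_coeff /= !exprS !exprM sqrrN -/u; ring.
  rewrite E.
  have F k' : \sum_(0 <= j < k'.+2) u ^+ j / (2 * j)`!%:R <=
      1 + u / 2 + u ^+ 2 / 16 * (1 - 3^-1 ^+ k').
    elim: k' => [|k' IH].
      rewrite big_nat_recr// big_nat1 expr0 subrr mulr0 addr0 fact0 divr1 /= expr1.
      exact: lexx.
    rewrite big_nat_recr//= (le_trans (lerD IH (lexx _)))//.
    have S : u ^+ k'.+2 / (2 * k'.+2)`!%:R <= u ^+ 2 / 24 * 3^-1 ^+ k'.
      elim: k' {IH} => [|k' IH]; first by rewrite expr0 mulr1.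
      have : (2 * k'.+3)%N = (2 * k'.+2).+2 by rewrite mulnS.
      move: IH; set N := (2 * k'.+2)%N => IH ->.
      have N4 : (4 <= N)%N by rewrite /N !mulnS.
      rewrite (factS N.+1) (factS N) 2!natrM exprS.
      set a : R := N.+2%:R; set b : R := N.+1%:R; set f : R := N`!%:R in IH *.
      have a3 : 3 <= a by rewrite ler_nat (leq_trans _ (leqW (leqW N4))).
      have b3 : 3 <= b by rewrite ler_nat (leq_trans _ (leqW N4)).
      have f0 : 0 < f by rewrite ltr0n fact_gt0.
      rewrite (_ : u * u ^+ k'.+2 / (a * (b * f)) = (u ^+ k'.+2 / f) * (u / (a * b))); last first.
        by field; rewrite !gt_eqF// (lt_le_trans _ a3, lt_le_trans _ b3).
      have ab0 : 0 < a * b by rewrite mulr_gt0; lra.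
      have ab9 : 9 <= a * b.
        by rewrite (_ : 9 = 3 * 3) ?ler_pM//; ring.
      have h1 : u / (a * b) <= 3^-1.
        rewrite ler_pdivrMr//; have : u <= 2 by exact: t2.
        by move: (a * b) ab9 => z; lra.
      rewrite [X in _ <= _ * X]exprSr [leRHS]mulrA; apply: ler_pM => //.
        exact: divr_ge0 (exprn_ge0 _ u0) (ltW f0).
      exact: divr_ge0 u0 (ltW ab0).
    rewrite (le_trans (lerD (lexx _) S))// [3^-1 ^+ k'.+1]exprS; lra.
  case: k {E} => [|[|k]].
  - rewrite big_geq// mulr0; nra.
  - rewrite big_nat1 expr0 fact0; nra.
  - have := F k; set s := \sum_(_ <= _ < _) _ => Fk.
    have : 0 <= 3^-1 ^+ k :> R by rewrite exprn_ge0.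
    rewrite (_ : t ^+ 4 = u ^+ 2); last by rewrite /u -exprM.
    nra.
have c1 := is_cvg_series_exp_coeff t; have c2 := is_cvg_series_exp_coeff (- t).
rewrite /expR -limD//; apply: limr_le; first exact: is_cvgD.
apply: nearW => k; rewrite (le_trans _ (H k))// /series /=.
rewrite [in leRHS](big_cat_nat (n := k))//=; last by rewrite mul2n -addnn leq_addr.
rewrite big_split lerDl sumr_ge0// => j _.
rewrite /exp_coeff /= -mulrDl divr_ge0//.
rewrite exprNn -signr_odd; case: (boolP (odd j)) => [_|j_even] /=.
  by rewrite expr1 mulN1r subrr.
by rewrite expr0 mul1r addr_ge0// exprn_even_ge0.
Qed.

Lemma fact_double_le d : ((2 * d)`! <= 4 ^ d * d`! * d`!)%N.
Proof.
have dd : (d <= 2 * d)%N by rewrite mul2n -addnn leq_addr.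
rewrite -(bin_fact dd) mul2n -addnn addnK -mulnA leq_mul2r; apply/orP; right.
rewrite (_ : 4 ^ d = 2 ^ (d + d))%N; last by rewrite addnn -mul2n expnM.
have := expnDn 1 1 (d + d); rewrite addn1 => ->.
rewrite (bigD1 (Ordinal (leq_addr d d : d < (d + d).+1)%N))//=.
by rewrite !exp1n !muln1 leq_addr.
Qed.

Lemma fact_le_expR d : (0 < d)%N ->
  d`!%:R <= d%:R * d%:R ^+ d * expR (1 - d%:R) :> R.
Proof.
elim: d => // -[_ _|d IH _]; first by rewrite subrr expR0 expr1 !mulr1.
rewrite factS natrM -mulrA ler_wpM2l// (le_trans (IH _))//.
set a : R := d.+1%:R; set b : R := d.+2%:R.
have a0 : 0 < a by rewrite ltr0n. have b0 : 0 < b by rewrite ltr0n.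
have ab : a = b - 1 by rewrite /b -natr1 addrK.
have -> : expR (1 - a) = expR (1 - b) * expR 1 by rewrite -expRD ab; congr expR; ring.
rewrite -exprS mulrCA [leRHS]mulrC ler_wpM2l ?expR_ge0//.
have h : a / b <= expR (- b^-1).
  rewrite ab mulrBl divff ?gt_eqF// mul1r; exact: expR_ge1Dx.
have h2 : (a / b) ^+ d.+2 <= expR (- 1).
  rewrite (_ : - 1 = - b^-1 * b); last by rewrite mulNr mulVf ?gt_eqF.
  rewrite expRM_natr lerXn2r ?nnegrE ?expR_ge0// divr_ge0// ltW//.
rewrite -ler_pdivlMr ?expR_gt0// -expRN mulrC -ler_pdivrMr ?exprn_gt0//.
by rewrite -expr_div_n.
Qed.

Lemma sum_geometric_le q n : 0 <= q < 1 -> \sum_(i < n) q ^+ i <= (1 - q)^-1.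
Proof.
move=> /andP[q0 q1]; have q10 : 0 < 1 - q by rewrite subr_gt0.
rewrite -[leRHS]mul1r ler_pdivlMr// mulrC -opprB mulNr -subrX1 opprB.
by rewrite gerBl exprn_ge0.
Qed.

(** Since [i q^i] is at most the sum of the first [i] powers of [q]. *)
Lemma sum_arith_geometric_le q n : 0 <= q < 1 ->
  \sum_(i < n) i%:R * q ^+ (2 * i) <= (1 - q)^-1 ^+ 2.
Proof.
move=> q01; have /andP[q0 q1] := q01.
have q10 : 0 <= (1 - q)^-1 by rewrite invr_ge0 subr_ge0 ltW.
rewrite expr2 (le_trans _ (ler_wpM2l q10 (sum_geometric_le n q01)))// mulr_sumr.
apply: ler_sum => i _; rewrite mul2n -addnn exprD mulrA ler_wpM2r ?exprn_ge0//.
rewrite (le_trans _ (sum_geometric_le i q01))//.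
rewrite -[X in X%:R](card_ord i) -sumr_const mulr_suml.
by apply: ler_sum => j _; rewrite mul1r; apply: ler_wiXn2l; rewrite ?(ltW q1)// ltnW.
Qed.

End elementary_bounds.

(** * Moments of the overlap *)

Section overlap_moments.
Context (R : realType) (n : nat) (lambda rho : R).
Hypotheses (n0 : (0 < n)%N) (rho01 : 0 < rho <= 1).
Notation TR := (measurableTypeR R).
Notation word := (words 'I_3 n).
Notation weight := (word_weight (rademacher_weight rho) (n:=n)).
Notation value := (word_value (rademacher_value n rho : 'I_3 -> TR) (n:=n)).

Let overlap (u v : word) : R := \sum_i tnth (value u) i * tnth (value v) i.

Let rho0 : 0 < rho. Proof. by case/andP: rho01. Qed.
Let nR0 : 0 < n%:R :> R. Proof. by rewrite ltr0n. Qed.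

Let weight_ge0 (u : word) : 0 <= weight u.
Proof. exact: (finite_law_power n (finite_law_sparse_rademacher_entry n rho01)).1. Qed.

Let sum_weight : \sum_(u : word) weight u = 1.
Proof.
apply: (sum_word_weight (T := TR) (rademacher_value n rho)).
by rewrite !big_ord_recr big_ord0 /= /rademacher_weight /=; field.
Qed.

(** Moment generating function of the overlap of two independent spikes; each
    coordinate contributes a symmetric step of size 1 / (rho n), which is nonzero
    with probability [rho ^+ 2]. *)
Lemma overlap_mgf (tau : R) :
  \sum_(u : word) \sum_(v : word) weight u * weight v * expR (tau * overlap u v) =
  (1 - rho ^+ 2 + rho ^+ 2 *
    ((expR (tau / (rho * n%:R)) + expR (- (tau / (rho * n%:R)))) / 2)) ^+ n.
Proof.
pose G (x : TR) : R := \sum_j rademacher_weight rho j * expR (tau * (x * rademacher_value n rho j)).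
have E1 u : \sum_(v : word) weight u * weight v * expR (tau * overlap u v) =
    weight u * \prod_i G (tnth (value u) i).
  rewrite /G -(sum_word_weight_prod (rademacher_weight rho) (rademacher_value n rho : 'I_3 -> TR)
    (fun i (y : TR) => expR (tau * (tnth (value u) i * y)))).
  rewrite mulr_sumr; apply: eq_bigr => v _.
  by rewrite -mulrA /overlap mulr_sumr expR_sum.
under eq_bigr do rewrite E1.
rewrite (sum_word_weight_prod (rademacher_weight rho) (rademacher_value n rho : 'I_3 -> TR) (fun _ => G)).
rewrite prodr_const card_ord; congr (_ ^+ n).
have sq : (Num.sqrt (rho * n%:R))^-1 * (Num.sqrt (rho * n%:R))^-1 = (rho * n%:R)^-1 :> R.
  by rewrite -expr2 exprVn sqr_sqrtr// mulr_ge0// ltW.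
rewrite /G /rademacher_weight /rademacher_value !big_ord_recr !big_ord0 /=.
by rewrite !(mulNr, mulrN, opprK, mulr0, mul0r, oppr0, expR0) sq; field.
Qed.

(** Chernoff-type bound: the moment generating function at t rho n dominates
    the corresponding multiple of the moment, for any admissible [t]. *)
Lemma overlap_moment_le d t : (0 < d)%N -> t != 0 -> t ^+ 2 <= 2 ->
  \sum_(u : word) \sum_(v : word) weight u * weight v * overlap u v ^+ (2 * d) <=
  2 * (2 * d)`!%:R / (t ^+ 2 * (rho * n%:R) ^+ 2) ^+ d *
    expR (n%:R * rho ^+ 2 * (t ^+ 2 / 2 + t ^+ 4 / 16)).
Proof.
move=> d0 t0 t2; pose tau := t * (rho * n%:R).
have rn0 : rho * n%:R != 0 by rewrite mulf_neq0 ?gt_eqF.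
have tauE : tau / (rho * n%:R) = t by rewrite mulfK.
have tau0 : 0 < (t ^+ 2 * (rho * n%:R) ^+ 2) ^+ d.
  by rewrite exprn_gt0// mulr_gt0// exprn_even_gt0//= ?t0 ?rn0.
have f0 : 0 < (2 * d)`!%:R :> R by rewrite ltr0n fact_gt0.
have tauX : tau ^+ (2 * d) = (t ^+ 2 * (rho * n%:R) ^+ 2) ^+ d.
  by rewrite exprM; congr (_ ^+ d); rewrite /tau exprMn.
set T := (_ * _) ^+ d in tau0 tauX *; set E := expR _.
have -> : 2 * (2 * d)`!%:R / T * E = 2 * E * ((2 * d)`!%:R / T) by ring.
rewrite -ler_pdivrMr ?divr_gt0// invf_div mulr_suml.
under eq_bigr do rewrite mulr_suml.
pose M := (1 - rho ^+ 2 + rho ^+ 2 * ((expR t + expR (- t)) / 2)) ^+ n.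
apply: (@le_trans _ _ (2 * M)).
  rewrite mulr2n mulrDl mul1r {1}/M -{1 2}tauE -overlap_mgf.
  have -> : M = \sum_(u : word) \sum_(v : word) weight u * weight v * expR (- tau * overlap u v).
    by rewrite overlap_mgf mulNr tauE opprK /M (addrC (expR (- t))).
  rewrite -big_split; apply: ler_sum => u _ /=; rewrite -big_split; apply: ler_sum => v _ /=.
  rewrite -mulrDr -(mulrA (weight u * weight v)) ler_wpM2l ?mulr_ge0//.
  have := expRDN_ge_pow (tau * overlap u v) d0.
  by rewrite mulNr exprMn tauX mulrA (mulrC T).
rewrite ler_wpM2l// /M /E -mulrA expRM_natl lerXn2r ?nnegrE ?expR_ge0//.
  have /andP[_ r1] := rho01.
  have r21 : rho ^+ 2 <= 1 by rewrite expr_le1// ltW.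
  by rewrite addr_ge0 ?subr_ge0 ?(mulr_ge0 (sqr_ge0 _)) ?divr_ge0 ?addr_ge0 ?expR_ge0.
rewrite (le_trans _ (expR_ge1Dx _))//.
have h := expRDN_le t2.
have r20 : 0 <= rho ^+ 2 by exact: sqr_ge0.
nra.
Qed.

Let m : R := n%:R * rho ^+ 2.
Let m0 : 0 < m. Proof. by rewrite mulr_gt0// exprn_gt0. Qed.

Lemma projection_term_le d t : (0 < d)%N -> t != 0 -> t ^+ 2 <= 2 ->
  \sum_(u : word) \sum_(v : word) weight u * weight v *
    ((lambda ^+ 2 * n%:R / 2 * overlap u v ^+ 2) ^+ d / d`!%:R) <=
  2 * d%:R * (2 * d%:R * lambda ^+ 2 / (t ^+ 2 * m)) ^+ d *
    expR (1 - d%:R + m * (t ^+ 2 / 2 + t ^+ 4 / 16)).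
Proof.
move=> d0 t0 t2.
have tt0 : 0 < t ^+ 2 by rewrite exprn_even_gt0//= t0.
have df0 : 0 < d`!%:R :> R by rewrite ltr0n fact_gt0.
pose k : R := (lambda ^+ 2 * n%:R / 2) ^+ d / d`!%:R.
have k0 : 0 <= k.
  by rewrite divr_ge0// exprn_ge0// divr_ge0// mulr_ge0// ?sqr_ge0// ltW.
rewrite (_ : \sum_u _ = k * \sum_(u : word) \sum_(v : word) weight u * weight v * overlap u v ^+ (2 * d)); last first.
  rewrite mulr_sumr; apply: eq_bigr => u _; rewrite mulr_sumr; apply: eq_bigr => v _.
  rewrite exprMn -exprM /k; ring.
rewrite (le_trans (ler_wpM2l k0 (overlap_moment_le d0 t0 t2)))// -/m expRD.
rewrite [leRHS]mulrA mulrA ler_wpM2r ?expR_ge0//.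
have F : (2 * d)`!%:R <= 4 ^+ d * d`!%:R * (d%:R * d%:R ^+ d * expR (1 - d%:R)) :> R.
  apply: (@le_trans _ _ (4 ^+ d * d`!%:R * d`!%:R)).
    by rewrite -natrX -!natrM ler_nat fact_double_le.
  by rewrite ler_wpM2l ?mulr_ge0 ?exprn_ge0 ?fact_le_expR// ltW.
have P0 : 0 <= k * 2 / (t ^+ 2 * (rho * n%:R) ^+ 2) ^+ d.
  apply: divr_ge0; first exact: mulr_ge0.
  by apply: exprn_ge0; apply: mulr_ge0; exact: sqr_ge0.
rewrite (_ : k * _ = k * 2 / (t ^+ 2 * (rho * n%:R) ^+ 2) ^+ d * (2 * d)`!%:R); last by ring.
rewrite (le_trans (ler_wpM2l P0 F))// le_eqVlt; apply/orP; left; apply/eqP.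
have -> : 2 * d%:R * lambda ^+ 2 / (t ^+ 2 * m) =
   (lambda ^+ 2 * n%:R / 2) / (t ^+ 2 * (rho * n%:R) ^+ 2) * 4 * d%:R.
  by rewrite /m; field; rewrite ?t0 ?(gt_eqF rho0) ?(gt_eqF nR0).
have X4 (a b c : R) : (a / b * 4 * c) ^+ d = a ^+ d / b ^+ d * 4 ^+ d * c ^+ d.
  by rewrite !exprMn exprVn.
rewrite X4 /k; move: (_ ^+ d) (_ ^+ d) (expR _) => a b e.
have Y (f f' a' b' c x y e' : R) : f' * f = 1 ->
    b' * f' * 2 * a' * (x * f * (c * y * e')) = 2 * c * (b' * a' * x * y) * e'.
  by move=> h; rewrite -[RHS]mul1r -h; ring.
by apply: Y; rewrite mulVf ?gt_eqF.
Qed.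

(** The free parameter [t] of the moment bound may depend on the degree [d]. *)
Lemma projection_sqr_norm_le D q : 0 <= q < 1 ->
    (forall d, (0 < d <= D)%N -> exists t, [/\ t != 0, t ^+ 2 <= 2 &
      (2 * d%:R * lambda ^+ 2 / (t ^+ 2 * m)) ^+ d *
        expR (- d%:R + m * (t ^+ 2 / 2 + t ^+ 4 / 16)) <= q ^+ (2 * d)]) ->
  projection_sqr_norm n lambda rho D <= 1 + 2 * expR 1 * (1 - q)^-1 ^+ 2.
Proof.
move=> q01 H; have /andP[q0 q1] := q01.
have -> : projection_sqr_norm n lambda rho D = \sum_(d < D.+1)
    \sum_(u : word) \sum_(v : word) weight u * weight v *
    ((lambda ^+ 2 * n%:R / 2 * overlap u v ^+ 2) ^+ d / d`!%:R).
  rewrite exchange_big; apply: eq_bigr => u _ /=.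
  by rewrite exchange_big; apply: eq_bigr => v _ /=; rewrite mulr_sumr.
rewrite big_ord_recl lerD//.
  rewrite (_ : \sum_u _ = 1) // -[RHS]sum_weight; apply: eq_bigr => u _.
  under eq_bigr do rewrite expr0 fact0 divr1 mulr1.
  by rewrite -mulr_sumr sum_weight mulr1.
have e20 : 0 <= 2 * expR 1 :> R by rewrite mulr_ge0// expR_ge0.
rewrite (le_trans _ (ler_wpM2l e20 (sum_arith_geometric_le D.+1 q01)))//.
rewrite big_ord_recl mul0r add0r mulr_sumr.
apply: ler_sum => i _.
have [|t [t0 t2 ht]] := H (lift ord0 i) _; first by rewrite /= ltn_ord.
rewrite (le_trans (projection_term_le _ t0 t2))//.
set d := lift ord0 i in ht *.
rewrite -addrA expRD.
set a := _ ^+ d in ht *; set e := expR (- _ + _) in ht *.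
rewrite (_ : _ * _ = 2 * expR 1 * (d%:R * (a * e))); last by ring.
by rewrite ler_wpM2l ?mulr_ge0 ?expR_ge0// ler_wpM2l.
Qed.

End overlap_moments.

(** * The two regimes *)

Lemma limn_esup_lt_near (R : realType) (u : nat -> R) (c : R) :
    (limn_esup (fun n => (u n)%:E) < c%:E)%E ->
  exists2 l : R, l < c & \forall n \near \oo, u n <= l.
Proof.
pose v n := (u n)%:E; rewrite -/v => h.
have : (ereal_inf (range (esups v)) < c%:E)%E.
  by rewrite -(cvg_lim _ (@cvg_esups_inf _ v))// -limn_esup_lim.
move=> /ereal_inf_lt[_ [N _ <-] Nc].
have vN n : (N <= n)%N -> (v n <= esups v N)%E.
  by move=> Nn; apply: ereal_sup_ubound; exists n.
have fN : esups v N \is a fin_num.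
  rewrite fin_numE; apply/andP; split.
    by apply: contraTneq (vN N (leqnn N)) => ->.
  by apply: contraTneq Nc => ->.
exists (fine (esups v N)); first by rewrite -lte_fin fineK.
by exists N => // n /= Nn; rewrite -lee_fin fineK// vN.
Qed.

Section regimes.
Context (R : realType) (n D : nat) (lambda rho : R).
Hypotheses (n0 : (0 < n)%N) (rho01 : 0 < rho <= 1) (lambda0 : 0 < lambda).

Let m : R := n%:R * rho ^+ 2.
Let nR0 : 0 < n%:R :> R. Proof. by rewrite ltr0n. Qed.
Let m0 : 0 < m. Proof. by rewrite mulr_gt0// exprn_gt0//; case/andP: rho01. Qed.

Let sqrt_le_rho (c : R) : 0 <= c -> c * Num.sqrt (D%:R / n%:R) <= rho -> c ^+ 2 * D%:R <= m.
Proof.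
move=> c0 h; rewrite /m mulrC -ler_pdivrMl// mulrCA.
have : (c * Num.sqrt (D%:R / n%:R)) ^+ 2 <= rho ^+ 2.
  by rewrite lerXn2r ?nnegrE ?mulr_ge0 ?sqrtr_ge0//; case/andP: rho01 => /ltW.
rewrite exprMn sqr_sqrtr ?divr_ge0//.
by apply: le_trans; rewrite le_eqVlt; apply/orP; left; apply/eqP; ring.
Qed.

(** Signal-to-noise ratio bounded away from 1. The bound depends on [lambda] only
    through [l]. *)
Lemma projection_sqr_norm_moderate (l : R) : lambda <= l -> l < 1 ->
    Num.max 1 (Num.sqrt (1 / (6 * ln (1 / lambda)))) * Num.sqrt (D%:R / n%:R) <= rho ->
  projection_sqr_norm n lambda rho D <= 1 + 2 * expR 1 * (1 - expR (ln l / 4))^-1 ^+ 2.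
Proof.
move=> lel l1 h; have l0 : 0 < l by exact: lt_le_trans lel.
pose K : R := - ln lambda.
have Ke : ln (1 / lambda) = K by rewrite div1r lnV.
have lll : ln lambda <= ln l by rewrite ler_ln.
have lnl0 : ln l < 0 by rewrite ln_lt0// l0.
have K0 : 0 < K by rewrite oppr_gt0 (le_lt_trans lll).
have Dm : D%:R <= m.
  have := @sqrt_le_rho 1 ler01; rewrite expr1n mul1r mul1r; apply.
  by apply: le_trans h; rewrite ler_peMl ?sqrtr_ge0// le_max lexx.
have DK : D%:R <= 6 * K * m.
  have := @sqrt_le_rho (Num.sqrt (1 / (6 * K))) (sqrtr_ge0 _).
  rewrite sqr_sqrtr; last by rewrite divr_ge0// mulr_ge0// ltW.
  move=> H; rewrite -ler_pdivrMl ?mulr_gt0// mulrC -div1r mulrC; apply: H.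
  by apply: le_trans h; rewrite ler_wpM2r ?sqrtr_ge0// -Ke le_max lexx orbT.
apply: projection_sqr_norm_le => //.
  by rewrite expR_ge0 expR_lt1 pmulr_llt0// invr_gt0.
move=> d /andP[d0 dD]; rewrite -/m.
have dR0 : 0 < d%:R :> R by rewrite ltr0n.
have dm : d%:R <= m by rewrite (le_trans _ Dm)// ler_nat.
have dK : d%:R <= 6 * K * m by rewrite (le_trans _ DK)// ler_nat.
have tt0 : 0 < 2 * d%:R / m by rewrite divr_gt0// mulr_gt0.
(* At this t, the base of the d-th power is lambda ^+ 2. *)
exists (Num.sqrt (2 * d%:R / m)).
have t2 : Num.sqrt (2 * d%:R / m) ^+ 2 = 2 * d%:R / m by rewrite sqr_sqrtr// ltW.
have t4 : Num.sqrt (2 * d%:R / m) ^+ 4 = (2 * d%:R / m) ^+ 2 by rewrite (exprM _ 2 2) t2.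
split; first by rewrite gt_eqF// sqrtr_gt0.
  by rewrite t2 ler_pdivrMr// ler_pM2l.
rewrite t2 t4.
have -> : 2 * d%:R * lambda ^+ 2 / (2 * d%:R / m * m) = lambda ^+ 2.
  by field; rewrite !gt_eqF.
rewrite -exprM -{1}(lnK (lambda0 : lambda \is Num.pos)) -!expRM_natr -expRD ler_expR.
set x := d%:R / m.
have x6 : x <= 6 * K by rewrite ler_pdivrMr.
rewrite (_ : m * _ = d%:R * (1 + x / 4)); last by rewrite /x; field; rewrite gt_eqF.
rewrite natrM -(opprK (ln lambda)) -/K.
have Kl : - K <= ln l by rewrite opprK.
have : d%:R * (- K / 2) <= d%:R * (ln l / 2) by rewrite ler_pM2l// ler_pM2r.
have : d%:R * (x / 4) <= d%:R * (6 * K / 4) by rewrite ler_pM2l// ler_pM2r.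
lra.
Qed.

(** Weak signal: the sparsity may be smaller by a factor [lambda]. *)
Lemma projection_sqr_norm_weak : 3 * lambda ^+ 2 <= 1 ->
    lambda * Num.sqrt (D%:R / n%:R) <= rho ->
  projection_sqr_norm n lambda rho D <= 1 + 2 * expR 1 * (1 - expR (- (7 / 24)))^-1 ^+ 2.
Proof.
move=> l3 h; have Dm := sqrt_le_rho (ltW lambda0) h.
apply: projection_sqr_norm_le => //.
  by rewrite expR_ge0 expR_lt1 oppr_lt0 divr_gt0.
move=> d /andP[d0 dD]; rewrite -/m.
have dR0 : 0 < d%:R :> R by rewrite ltr0n.
have ll0 : 0 < lambda ^+ 2 by rewrite exprn_gt0.
have dm : lambda ^+ 2 * d%:R <= m by rewrite (le_trans _ Dm)// ler_wpM2l ?ler_nat// ltW.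
pose x := lambda ^+ 2 * d%:R / m.
have x1 : x <= 1 by rewrite ler_pdivrMr// mul1r.
have x0 : 0 < x by rewrite divr_gt0// mulr_gt0.
(* At this t, the base of the d-th power is exactly 1. *)
exists (Num.sqrt (2 * x)).
have t2 : Num.sqrt (2 * x) ^+ 2 = 2 * x by rewrite sqr_sqrtr// mulr_ge0// ltW.
have t4 : Num.sqrt (2 * x) ^+ 4 = (2 * x) ^+ 2 by rewrite (exprM _ 2 2) t2.
split; first by rewrite gt_eqF// sqrtr_gt0 mulr_gt0.
  by rewrite t2; lra.
rewrite t2 t4.
have -> : 2 * d%:R * lambda ^+ 2 / (2 * x * m) = 1.
  by rewrite /x; field; rewrite !gt_eqF.
rewrite expr1n mul1r -expRM_natr ler_expR natrM.
rewrite (_ : m * _ = lambda ^+ 2 * d%:R * (1 + x / 4)); last first.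
  by rewrite /x; field; rewrite gt_eqF.
have : lambda ^+ 2 * d%:R * (1 + x / 4) <= 3^-1 * d%:R * (1 + 1 / 4).
  apply: ler_pM.
  - by rewrite mulr_ge0// ltW.
  - by lra.
  - by rewrite ler_pM2r//; lra.
  - by lra.
lra.
Qed.

End regimes.

Lemma L2norm_le d (T : measurableType d) (R : realType) (Q : probability T R)
    (f : T -> R) (K : R) : 0 <= K ->
  ('E_Q[(fun y => f y ^+ 2)%R] <= K%:E)%E -> (L2norm Q f <= (K `^ 2^-1)%:E)%E.
Proof.
move=> K0 h; rewrite /L2norm -poweR_EFin.
apply: gt0_ler_poweR => //.
- by rewrite in_itv/= leey andbT expectation_ge0// => x; exact: sqr_ge0.
- by rewrite in_itv/= leey andbT lee_fin.
Qed.

Theorem theorem2p24 (R : realType) (D : nat -> nat) (rho lambda : nat -> R)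
    (L : forall n, symmx R n -> R) (LD : forall n, polymx R n)
    (rho_range : forall n, 0 < rho n <= 1)
    (lambda_gt0 : forall n, 0 < lambda n)
    (L_ratio : forall n, is_likelihood_ratio
      (spiked_wigner (lambda n) (sparse_rademacher n (rho n))) (GOE n) (L n))
    (LD_proj : forall n, is_low_degree_projection (GOE n) (D n) (L n) (LD n))
    (D_small : (fun n => (D n)%:R : R^o) =o_\oo (fun n => n%:R : R^o))
    (regime :
      ((limn_esup (fun n => (lambda n)%:E) < 1)%E /\
        \forall n \near \oo,
          Num.max 1 (Num.sqrt (1 / (6 * ln (1 / lambda n))))
            * Num.sqrt ((D n)%:R / n%:R) <= rho n) \/
      ((limn_esup (fun n => (lambda n)%:E) < (1 / Num.sqrt 3)%:E)%E /\
        \forall n \near \oo,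
          lambda n * Num.sqrt ((D n)%:R / n%:R) <= rho n)) :
  exists C : R, \forall n \near \oo,
    (L2norm (GOE n) (polymx_eval (LD n)) <= C%:E)%E.
Proof.
suff [K K0 HK] : exists2 K : R, 0 <= K & \forall n \near \oo,
    projection_sqr_norm n (lambda n) (rho n) (D n) <= K.
  exists (K `^ 2^-1); near=> n; apply: L2norm_le => //.
  have n0 : (0 < n)%N by near: n; exact: nbhs_infty_gt.
  apply: le_trans (low_degree_projection_bound n0 (rho_range n) (L_ratio n) (LD_proj n)) _.
  by rewrite lee_fin; near: n.
have C0 (q : R) : 0 <= 1 + 2 * expR 1 * (1 - q)^-1 ^+ 2.
  by rewrite addr_ge0// mulr_ge0 ?sqr_ge0// mulr_ge0// expR_ge0.
case: regime => -[/limn_esup_lt_near[l lc hl] hrho].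
  exists (1 + 2 * expR 1 * (1 - expR (ln l / 4))^-1 ^+ 2); first exact: C0.
  near=> n; apply: projection_sqr_norm_moderate => //.
  - by near: n; exact: nbhs_infty_gt.
  - by near: n.
  - by near: n.
exists (1 + 2 * expR 1 * (1 - expR (- (7 / 24)))^-1 ^+ 2); first exact: C0.
near=> n; apply: projection_sqr_norm_weak => //.
- by near: n; exact: nbhs_infty_gt.
- have ln3 : lambda n <= 1 / Num.sqrt 3.
    by apply: (le_trans _ (ltW lc)); near: n.
  have s3 : Num.sqrt 3 ^+ 2 = 3 :> R by rewrite sqr_sqrtr.
  have : lambda n ^+ 2 <= (1 / Num.sqrt 3) ^+ 2.
    by rewrite lerXn2r ?nnegrE ?divr_ge0 ?sqrtr_ge0// ltW.
  by rewrite div1r exprVn s3; lra.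
- by near: n.
Unshelve. all: by end_near.
Qed.
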